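(* Let $\Gamma\in\mathcal U_\infty$. (i) $\Gamma$ is connected if and only if $|\mathcal C_1(G(n,\Gamma))|/n\to1$ in probability as $n\to\infty$. (ii) More precisely, for every $\Gamma$, $|\mathcal C_1(G(n,\Gamma))|/n\to\rho$ in probability as $n\to\infty$ for some $\rho\in[0,1]$; if $\Gamma$ is connected, then $\rho=1$, while if $\Gamma$ is disconnected, then $0\le\rho<1$. Furthermore, $\rho=0$ if and only if $\Gamma=\mathbf 0$ (in which case $G(n,\Gamma)=E_n$ almost surely, where $E_n$ is the graph on $\{1,\dots,n\}$ with no edges). In fact, if $\Gamma$ has the decomposition $\Gamma=\bigoplus_{i=1}^M\alpha_i\Gamma_i$ into components, where $0\le M\le\infty$, every $\Gamma_i\in\mathcal U_\infty$ is connected, every $\alpha_i>0$ and $\sum_{i=1}^M\alpha_i\le1$, then $\rho=\max_i\alpha_i$ (with $\rho=0$ if $M=0$).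
   Context: Graphs are finite, simple, undirected, with at least one vertex, unless explicitly infinite; $v(G)=|V(G)|$, $e(G)=|E(G)|$. $\mathcal C_1(G)$ is the largest (in number of vertices) connected component of a graph $G$, ties split arbitrarily, and $|\mathcal C_1(G)|$ is its number of vertices. Graph limits. For graphs $F,G$, $t(F,G)$ is the probability that a uniformly random map $V(F)\to V(G)$ is a graph homomorphism (maps edges to edges). The set $\mathcal U$ of unlabelled graphs (isomorphism classes) is embedded as a dense subset of a compact metric space $\overline{\mathcal U}$; the elements of $\mathcal U_\infty=\overline{\mathcal U}\setminus\mathcal U$ are called graph limits, and $v(\Gamma)=\infty$ for $\Gamma\in\mathcal U_\infty$. Each $t(F,\cdot)$ extends continuously to $\overline{\mathcal U}$; a graph limit $\Gamma$ is determined by the numbers $t(F,\Gamma)$, $F$ ranging over all graphs; and a sequence $G_n$ in $\overline{\mathcal U}$ converges to $\Gamma\in\mathcal U_\infty$ iff $v(G_n)\to\infty$ and $t(F,G_n)\to t(F,\Gamma)$ for every graph $F$. (Concretely, graph limits can be identified with the families $(t_F)_F$ arising as $t_F=\lim_n t(F,G_n)$ for sequences of graphs with $v(G_n)\to\infty$ for which all these limits exist.) The trivial graph limit $\mathbf 0$ is the one with $t(F,\mathbf 0)=0$ if $e(F)\ge1$ and $1$ if $e(F)=0$. Direct sums and connectedness. For $0\le m\le\infty$, graph limits $(\Gamma_i)_{i=1}^m$ and weights $\alpha_i\ge0$ with $\sum_{i=1}^m\alpha_i\le1$, $\bigoplus_{i=1}^m\alpha_i\Gamma_i$ is the unique graph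 limit $\Gamma$ with $t(F,\Gamma)=\sum_{i=1}^m\alpha_i^{v(F)}t(F,\Gamma_i)$ for every connected graph $F$ with at least one edge (for $m=0$ it is $\mathbf 0$); for $m=2$ and weights $\alpha,1-\alpha$ it is written $\alpha\Gamma_1\oplus(1-\alpha)\Gamma_2$. A graph limit $\Gamma$ is disconnected if there exist $\Gamma_1,\Gamma_2\in\mathcal U_\infty$ and $\alpha\in(0,1)$ with $\Gamma=\alpha\Gamma_1\oplus(1-\alpha)\Gamma_2$; otherwise it is connected. Every graph limit has a decomposition into components of the form stated in the claim, unique up to simultaneous permutation of the $\Gamma_i$ and $\alpha_i$. Random graphs. A kernel on a probability space $(\mathcal S,\mu)$ is a symmetric measurable $W:\mathcal S\times\mathcal S\to[0,1]$; it represents the unique graph limit $\Gamma_W$ with $t(F,\Gamma_W)=\int_{\mathcal S^{v(F)}}\prod_{ij\in E(F)}W(x_i,x_j)\,d\mu(x_1)\cdots d\mu(x_{v(F)})$ for every graph $F$. Every graph limit is represented by some kernel. $G(\infty,\Gamma)$ is the infinite random graph with vertex set $\mathbb N=\{1,2,\dots\}$ obtained, for any kernel $W$ representing $\Gamma$, by taking i.i.d. $X_1,X_2,\dots$ with distribution $\mu$ and, conditionally given these, including each edge $ij$ ($i<j$) independently with probability $W(X_i,X_j)$. Its distribution depends only on $\Gamma$ and is characterized by $\mathbb P(G(\infty,\Gamma)\supseteq F)=t(F,\Gamma)$ for every graph $F$ with $V(F)=\{1,\dots,k\}$, $k\ge1$. $G(n,\Gamma)$ is the subgraph of $G(\infty,\Gamma)$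 induced by $\{1,\dots,n\}$. *)

(* Defs.v *)
From HB Require Import structures.
From mathcomp Require Import all_boot all_order all_algebra.
From mathcomp Require Import all_classical all_reals all_analysis.
Import Order.TTheory GRing.Theory Num.Theory.
Import numFieldNormedType.Exports.

Set Implicit Arguments.
Unset Strict Implicit.
Unset Printing Implicit Defensive.

Local Open Scope classical_set_scope.
Local Open Scope ring_scope.

(* Up to isomorphism a finite graph has vertex set {0, ..., v-1}; this also
   fixes the order of the coordinates in the integrals below. *)
Record graph := Graph {
  gv : nat;
  gv_gt0 : (0 < gv)%N;
  gedge : rel 'I_gv;
  gedge_sym : symmetric gedge;
  gedge_irr : irreflexive gedge }.

Definition edges (F : graph) : pred ('I_(gv F) * 'I_(gv F)) :=
  fun p => (p.1 < p.2)%N && gedge p.1 p.2.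

Definition ge (F : graph) : nat := #|@edges F|.

Definition graph_connected (F : graph) : Prop :=
  forall x y, connect (@gedge F) x y.

Definition largest_component_size (T : finType) (e : rel T) : nat :=
  \max_(x : T) #|connect e x|.

Section GraphLimits.
Variable R : realType.

Definition is_hom (F G : graph) : pred {ffun 'I_(gv F) -> 'I_(gv G)} :=
  fun f => [forall x, forall y, gedge x y ==> gedge (f x) (f y)].

Definition hom_density (F G : graph) : R :=
  #|@is_hom F G|%:R / #|{ffun 'I_(gv F) -> 'I_(gv G)}|%:R.

(* A graph limit Gamma is identified with the family of numbers t(F, Gamma),
   so that equality of graph limits is equality of functions. *)
Definition graph_limit (Gamma : graph -> R) : Prop :=
  exists G : nat -> graph,
    gv (G n) @[n --> \oo] --> \oo /\
    forall F, hom_density F (G n) @[n --> \oo] --> Gamma F.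

Definition trivial_limit : graph -> R := fun F => if ge F == 0%N then 1 else 0.

(* Numbers of summands range over {0, 1, ..., oo}; oo is None. Summands are
   indexed from 0, and [below M i] reads i < M. *)
Definition below (M : option nat) : pred nat :=
  fun i => if M is Some m then (i < m)%N else true.

Definition weights (M : option nat) (alpha : nat -> R) : Prop :=
  (forall i, below M i -> 0 <= alpha i) /\
  (\sum_(i <oo | below M i) (alpha i)%:E <= 1)%E.

Definition is_direct_sum (M : option nat) (alpha : nat -> R)
    (Gammas : nat -> graph -> R) (Gamma : graph -> R) : Prop :=
  forall F, graph_connected F -> (1 <= ge F)%N ->
    (Gamma F)%:E =
      (\sum_(i <oo | below M i) (alpha i ^+ gv F * Gammas i F)%:E)%E.

Definition is_direct_sum2 (alpha : R) (Gamma1 Gamma2 Gamma : graph -> R) :=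
  is_direct_sum (Some 2%N) (fun i => if i == 0%N then alpha else 1 - alpha)
    (fun i => if i == 0%N then Gamma1 else Gamma2) Gamma.

Definition limit_disconnected (Gamma : graph -> R) : Prop :=
  exists Gamma1 Gamma2 : graph -> R, exists alpha : R,
    [/\ graph_limit Gamma1, graph_limit Gamma2, 0 < alpha < 1 &
        is_direct_sum2 alpha Gamma1 Gamma2 Gamma].

Definition limit_connected (Gamma : graph -> R) : Prop :=
  ~ limit_disconnected Gamma.

Definition component_decomposition (M : option nat) (alpha : nat -> R)
    (Gammas : nat -> graph -> R) (Gamma : graph -> R) : Prop :=
  [/\ forall i, below M i ->
        [/\ graph_limit (Gammas i), limit_connected (Gammas i) & 0 < alpha i],
      weights M alpha &
      is_direct_sum M alpha Gammas Gamma].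

Definition is_max_weight (M : option nat) (alpha : nat -> R) (rho : R) : Prop :=
  if M == Some 0%N then rho = 0
  else (exists2 i, below M i & rho = alpha i) /\
       (forall i, below M i -> alpha i <= rho).

End GraphLimits.
Arguments trivial_limit {R}.

Section RandomGraphs.
Variable R : realType.

Definition is_kernel d (S : measurableType d) (W : S * S -> R) : Prop :=
  [/\ measurable_fun [set: S * S] W,
      forall x y, W (x, y) = W (y, x) &
      forall z, 0 <= W z <= 1].

(* Integral over the k-fold power of mu, as an iterated integral; for
   nonnegative measurable f this is the integral over the product measure by
   Tonelli's theorem. *)
Fixpoint power_integral d (S : measurableType d) (mu : probability S R)
    (k : nat) : (k.-tuple S -> \bar R) -> \bar R :=
  match k return (k.-tuple S -> \bar R) -> \bar R with
  | 0 => fun f => f [tuple]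
  | k'.+1 => fun f =>
      (\int[mu]_x power_integral mu (fun s => f (cons_tuple x s)))%E
  end.

Definition represents d (S : measurableType d) (mu : probability S R)
    (W : S * S -> R) (Gamma : graph -> R) : Prop :=
  forall F : graph,
    (Gamma F)%:E = power_integral mu (fun x : (gv F).-tuple S =>
      (\prod_(p | edges p) W (tnth x p.1, tnth x p.2))%:E).

Definition iid d (Omega : measurableType d) (P : probability Omega R)
    d' (S : measurableType d') (mu : probability S R)
    (X : nat -> Omega -> S) : Prop :=
  (forall i, measurable_fun [set: Omega] (X i)) /\
  forall n (A : 'I_n -> set S), (forall i, measurable (A i)) ->
    (P [set w | forall i : 'I_n, A i (X i w)] = \prod_(i < n) mu (A i))%E.

(* Given X_0, X_1, ..., the edges ij (i < j) of G are independent and present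
   with probability W(X_i, X_j). The events {X_i in A_i for all i < n},
   over all n and measurable A_i, form a pi-system generating sigma(X), so the
   conditional law is determined by its integrals over them. *)
Definition conditionally_independent_edges
    d (Omega : measurableType d) (P : probability Omega R)
    d' (S : measurableType d') (W : S * S -> R)
    (X : nat -> Omega -> S) (G : Omega -> rel nat) : Prop :=
  forall n (A : 'I_n -> set S) (H : rel 'I_n),
    (forall i, measurable (A i)) ->
    (P [set w | (forall i : 'I_n, A i (X i w)) /\
                (forall i j : 'I_n, (i < j)%N -> G w i j = H i j)] =
     \int[P]_(w in [set w | forall i : 'I_n, A i (X i w)])
       (\prod_(p : 'I_n * 'I_n | (p.1 < p.2)%N)
          (if H p.1 p.2 then W (X p.1 w, X p.2 w)
           else 1 - W (X p.1 w, X p.2 w)))%:E)%E.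

(* [G] is a version, on the probability space (Omega, P), of the infinite
   random graph G(oo, Gamma); its vertices are numbered from 0. *)
Definition is_random_graph d (Omega : measurableType d)
    (P : probability Omega R) (Gamma : graph -> R) (G : Omega -> rel nat) :
    Prop :=
  [/\ forall w, symmetric (G w),
      forall w, irreflexive (G w),
      forall i j, measurable [set w | G w i j] &
      exists d' (S : measurableType d') (mu : probability S R)
        (W : S * S -> R) (X : nat -> Omega -> S),
        [/\ is_kernel W, represents mu W Gamma, iid P mu X &
            conditionally_independent_edges P W X G]].

Definition induced_graph (g : rel nat) (n : nat) : rel 'I_n :=
  fun i j => g i j.

Definition C1_fraction (Omega : Type) (G : Omega -> rel nat) (n : nat)
    (w : Omega) : R :=
  (largest_component_size (induced_graph (G w) (n := n)))%:R / n%:R.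

Definition cvg_in_probability d (Omega : measurableType d)
    (P : probability Omega R) (Y : nat -> Omega -> R) (c : R) : Prop :=
  forall eps : R, 0 < eps ->
    P [set w | eps <= `|Y n w - c|] @[n --> \oo] --> 0%E.

End RandomGraphs.
Arguments C1_fraction {R Omega} G n w.

(* Main.v *)
Require Import Defs.
From HB Require Import structures.
From mathcomp Require Import all_boot all_order all_algebra.
From mathcomp Require Import all_classical all_reals all_analysis.
From mathcomp Require Import measurable_realfun ring lra zify.
Import Order.TTheory GRing.Theory Num.Theory.
Import numFieldNormedType.Exports.

(** Write [G(n)] for the random graph on [n] vertices and [conn k n] for the
probability that [k + 1] fixed vertices lie in one component of [G(n)]. This
probability increases with [n]; let [s k] be its limit.

The largest component is controlled by these numbers alone. If [Z] is the
fraction of vertices in the largest component of a finite graph and [Y k] the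
probability that [k + 1] random vertices lie in one component, then
[Z ^ (k + 1) <= Y k <= Z ^ k] ([comp_frac_conn]). The expectation of [Y k]
tends to [s k]. Its variance tends to zero: for two disjoint groups of
vertices, connection inside the first group can be witnessed, up to a small
probability, by vertices disjoint from those that witness connection inside the
second, and the subgraphs induced on disjoint vertex sets are independent. The
same argument works for every property of a few vertices that is preserved by
homomorphisms, subgraph containment included ([stat_avg_variance]). Hence there
is one number [rho], the component density, with
[rho ^ (k + 1) <= s k <= rho ^ k] for all [k], and since these intervals
shrink to a point as [k] grows, [Z] tends to [rho] in probability
([C1_fraction_cvg]).

The rest is about the numbers [s k].

- If [0 < rho < 1], sampled graphs [H] converge to [Gamma] while their largest
  components occupy a fraction tending to [rho]. A connected [F] is mapped
  entirely into the largest component or entirely outside it, so limits of the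
  two parts of [H] along an ultrafilter exhibit [Gamma] as a direct sum; if
  [rho = 0], edges have density zero, so [Gamma] is trivial, and a trivial limit
  is a direct sum of two copies of itself. So connected limits have [rho = 1]
  ([connected_density1]).

- The event that marked vertices are connected is a union, over connected graphs
  [F] that contain them, of the events that [F] is present, and unions of such
  graphs are again connected. By inclusion-exclusion its probability is a linear
  combination of the densities of connected graphs only, and therefore of
  [a_i ^ v(F) * t(F, Gamma_i)] when [Gamma] is a direct sum. The contribution of
  [Gamma_i] is the probability of connection in a sample of [Gamma_i] in which
  every vertex survives with probability [a_i] independently. It lies between [0]
  and [a_i ^ (k + 1)] and tends to [a_i ^ (k + 1)] times the value of [s k] for
  [Gamma_i] ([dilution_ge], [dilution_le]). So, for [k >= 1], [s k] is the sum
  of [a_i ^ (k + 1)] if all [Gamma_i] are connected, which makes [rho] the largest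
  [a_i] ([density_is_max_weight]); for a direct sum of two limits it gives
  [s 1 <= a ^ 2 + (1 - a) ^ 2 < 1], hence [rho < 1]
  ([density_lt1_of_disconnected]).

Everything up to this point is done with samples from finite graphs: a graph
limit is a limit of finite graphs, in which a sample is a uniformly random map
from the vertices, and statements pass to the limit. Kernels enter only at the
end, to identify the law of the given infinite random graph with the limit of
these laws ([random_graph_law]). *)

Set Implicit Arguments.
Unset Strict Implicit.
Unset Printing Implicit Defensive.

Local Open Scope classical_set_scope.
Local Open Scope ring_scope.

(** * Averages over finite sets *)

Section Mean.
Variable R : realType.
Implicit Types T I J : finType.

Definition mean T (g : T -> R) : R := (\sum_x g x) / #|T|%:R.

Lemma eq_mean T (g1 g2 : T -> R) : g1 =1 g2 -> mean g1 = mean g2.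
Proof. by move=> e; rewrite /mean (eq_bigr g2). Qed.

Lemma mean_ge0 T (g : T -> R) : (forall x, 0 <= g x) -> 0 <= mean g.
Proof. by move=> g0; rewrite divr_ge0// sumr_ge0. Qed.

Lemma ler_mean T (g1 g2 : T -> R) :
  (forall x, g1 x <= g2 x) -> mean g1 <= mean g2.
Proof. by move=> le; rewrite ler_wpM2r ?invr_ge0// ler_sum. Qed.

Lemma mean_cst T (c : R) : (0 < #|T|)%N -> mean (fun _ : T => c) = c.
Proof.
move=> T0; rewrite /mean sumr_const -[c *+ _]mulr_natr mulfK//.
by rewrite pnatr_eq0 -lt0n.
Qed.

Lemma meanD T (g1 g2 : T -> R) :
  mean (fun x => g1 x + g2 x) = mean g1 + mean g2.
Proof. by rewrite /mean big_split mulrDl. Qed.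

Lemma meanZ T c (g : T -> R) : mean (fun x => c * g x) = c * mean g.
Proof. by rewrite /mean -mulr_sumr mulrA. Qed.

Lemma meanN T (g : T -> R) : mean (fun x => - g x) = - mean g.
Proof. by rewrite /mean sumrN mulNr. Qed.

Lemma mean_sum T I (P : pred I) (g : I -> T -> R) :
  mean (fun x => \sum_(i | P i) g i x) = \sum_(i | P i) mean (g i).
Proof. by rewrite /mean exchange_big/= mulr_suml. Qed.

Lemma mean_mean T I (g : I -> T -> R) :
  mean (fun x => mean (fun i => g i x)) = mean (fun i => mean (g i)).
Proof.
rewrite /mean -!mulr_suml exchange_big/= mulrAC.
by congr (_ / _ / _).
Qed.

Lemma mean_le1 T (g : T -> R) : (forall x, g x <= 1) -> mean g <= 1.
Proof.
move=> g1; have [T0|T0] := posnP #|T|.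
  by rewrite /mean T0 invr0 mulr0.
by rewrite -[leRHS](mean_cst 1 T0); exact: ler_mean.
Qed.

(** Restricting a uniformly random function along an injection gives a uniformly
random function, because all fibres of the restriction have the same size. *)
Lemma mean_ffun_inj T I J (h : I -> J) (g : {ffun I -> T} -> R) :
    (0 < #|T|)%N -> injective h ->
  mean (fun f : {ffun J -> T} => g [ffun i => f (h i)]) = mean g.
Proof.
move=> T0 hinj.
(* The fibre over [f0] is a product: values on the range of [h] are prescribed, all
   others are free. *)
pose F (f0 : {ffun I -> T}) (j : J) : pred T :=
  if [pick i | h i == j] is Some i then pred1 (f0 i) else predT.
pose c (j : J) := if j \in codom h then 1%N else #|T|.
have cF f0 j : #|F f0 j| = c j.
  rewrite /F /c; case: pickP => [i /eqP <-|nij]; first by rewrite codom_f card1.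
  case: (boolP (j \in codom h)) => // /codomP[i ji].
  by have := nij i; rewrite ji eqxx.
have fib f0 : #|[pred f : {ffun J -> T} | [ffun i => f (h i)] == f0]| =
    (\prod_j c j)%N.
  rewrite (@eq_card _ _ (family (F f0))); last first.
    move=> f; rewrite inE; apply/eqP/familyP => [<- j|fF].
      by rewrite /F; case: pickP => // i /eqP <-; rewrite inE ffunE.
    apply/ffunP => i; rewrite ffunE; have := fF (h i).
    rewrite /F; case: pickP => [i' /eqP/hinj ->|/(_ i)]; last by rewrite eqxx.
    by rewrite inE => /eqP.
  by rewrite card_family foldrE big_image/=; apply: eq_bigr => j _; exact: cF.
have sumE (g' : {ffun I -> T} -> R) :
    \sum_(f : {ffun J -> T}) g' [ffun i => f (h i)] =
    (\prod_j c j)%:R * \sum_f0 g' f0.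
  rewrite (partition_big (fun f : {ffun J -> T} => [ffun i => f (h i)]) xpredT)//=.
  rewrite mulr_sumr; apply: eq_bigr => f0 _.
  rewrite (eq_bigr (fun=> g' f0)); last by move=> f /eqP ->.
  by rewrite sumr_const fib mulr_natl.
have := sumE (fun=> 1); rewrite !sumr_const => cE.
rewrite /mean sumE cE -mulf_div divff ?mul1r//.
rewrite pnatr_eq0 -lt0n prodn_gt0// => j.
by rewrite /c; case: ifP.
Qed.

(** The two restrictions of a uniformly random function on a disjoint union are
independent; this is the only source of independence for finite samples. *)
Lemma mean_ffun_sum T I J (g1 : {ffun I -> T} -> R) (g2 : {ffun J -> T} -> R) :
  mean (fun f : {ffun I + J -> T} =>
          g1 [ffun i => f (inl i)] * g2 [ffun j => f (inr j)]) =
  mean g1 * mean g2.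
Proof.
rewrite /mean mulf_div; congr (_ / _); last first.
  by rewrite !card_ffun card_sum expnD natrM.
rewrite big_distrlr/= pair_big/=.
pose glue (p : {ffun I -> T} * {ffun J -> T}) : {ffun I + J -> T} :=
  [ffun x => match x with inl i => p.1 i | inr j => p.2 j end].
pose cut (f : {ffun I + J -> T}) := ([ffun i => f (inl i)], [ffun j => f (inr j)]).
rewrite (reindex glue)/=.
  apply: eq_bigr => -[f1 f2] _.
  by congr (g1 _ * g2 _); apply/ffunP => x; rewrite !ffunE.
exists cut => [[f1 f2] _|f _]; rewrite /cut /glue.
  by congr (_, _); apply/ffunP => x; rewrite !ffunE.
by apply/ffunP => -[x|x]; rewrite !ffunE.
Qed.

(** The common source of the two uses of inclusion-exclusion below: for the law of
a sample, where [w] ranges over edges, and for connectedness, where it ranges over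
connecting subgraphs. *)
Lemma prod_1sub (T : finType) (D : {set T}) (w : T -> R) :
  \prod_(p in D) (1 - w p) =
  \sum_(B : {set T} | B \subset D) (-1) ^+ #|B| * \prod_(p in B) w p.
Proof.
rewrite big_mkcond/= (eq_bigr (fun p =>
  (if p \in D then - w p else 0) + 1)); last first.
  move=> p _; case: ifP => _; last by rewrite add0r.
  by rewrite addrC.
rewrite bigA_distr [RHS]big_mkcond/=; apply: eq_bigr => B _.
rewrite -big_mkcond/=; case: ifPn => [BD|/fintype.subsetPn[p pB pD]].
  rewrite -prodrN; apply: eq_bigr => p pB.
  by rewrite (fintype.subsetP BD).
by rewrite (bigD1 p)//= (negPf pD) mul0r.
Qed.

Lemma prod_if (T : finType) (U H : {set T}) (w : T -> R) : H \subset U ->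
  \prod_(p in U) (if p \in H then w p else 1 - w p) =
  \sum_(B : {set T} | B \subset U :\: H)
     (-1) ^+ #|B| * \prod_(p in H :|: B) w p.
Proof.
move=> HU; rewrite (big_setID H)/= (finset.setIidPr HU).
rewrite (eq_bigr w); last by move=> p ->.
rewrite [X in _ * X](eq_bigr (fun p => 1 - w p)); last first.
  by move=> p /[!inE] /andP[/negPf ->].
rewrite prod_1sub mulr_sumr; apply: eq_bigr => B BU.
rewrite mulrCA; congr (_ * _).
rewrite -bigU/=; last first.
  rewrite disjoint_sym; apply: (disjointWl BU).
  by rewrite disjoint_subset; apply/fintype.subsetP => p /[!inE] /andP[].
by apply: eq_bigl => p; rewrite !inE.
Qed.

Lemma prod_bool (T : finType) (B : {set T}) (b : pred T) :
  \prod_(p in B) (b p)%:R = (B \subset b)%:R :> R.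
Proof.
case: (boolP (B \subset b)) => [/fintype.subsetP Bb|/fintype.subsetPn[p pB pb]].
  by rewrite big1// => p /Bb; rewrite unfold_in => ->.
by rewrite (bigD1 p)//= (_ : b p = false) ?mul0r//; apply/negbTE.
Qed.

End Mean.

(** * Sampling from graphs and from graph limits *)

Definition pull (V I : Type) (e : rel V) (f : I -> V) : rel I :=
  fun x y => e (f x) (f y).

(** Labelled graphs are coded by sets of ordered pairs, which form a finite type to sum
over. Every set of pairs is read as a graph, so that no side condition is needed
to form [graph_of]. *)
Definition srel n (H : {set 'I_n * 'I_n}) : rel 'I_n :=
  fun x y => (x != y) && (((x, y) \in H) || ((y, x) \in H)).

Lemma srel_sym n (H : {set 'I_n * 'I_n}) : symmetric (srel H).
Proof. by move=> x y; rewrite /srel eq_sym orbC. Qed.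

Lemma srel_irr n (H : {set 'I_n * 'I_n}) : irreflexive (srel H).
Proof. by move=> x; rewrite /srel eqxx. Qed.

Definition graph_of n (H : {set 'I_n.+1 * 'I_n.+1}) : graph :=
  Graph (ltn0Sn n) (@srel_sym _ H) (@srel_irr _ H).

Definition upper_pairs n : {set 'I_n * 'I_n} := [set p : 'I_n * 'I_n | (p.1 < p.2)%N].

(** The canonical code of a graph, with every edge listed once as an increasing pair. *)
Definition edge_set n (e : rel 'I_n) : {set 'I_n * 'I_n} :=
  [set p in upper_pairs n | e p.1 p.2].

Lemma edge_set_sub n (e : rel 'I_n) : edge_set e \subset upper_pairs n.
Proof. by apply/fintype.subsetP => p; rewrite inE => /andP[]. Qed.

Lemma edge_setK n (e : rel 'I_n) : symmetric e -> irreflexive e ->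
  srel (edge_set e) = e.
Proof.
move=> es ei; apply/funext => x; apply/funext => y.
rewrite /srel !inE /=; case: (ltngtP x y) => [xy|xy|/val_inj <-] /=.
- by rewrite orbF andb_idl// => _; rewrite neq_ltn xy.
- by rewrite es andb_idl// => _; rewrite neq_ltn xy orbT.
- by rewrite eqxx ei.
Qed.

Lemma pull_sym V I (e : rel V) (f : I -> V) :
  symmetric e -> symmetric (pull e f).
Proof. by move=> es x y; exact: es. Qed.

Lemma pull_irr V I (e : rel V) (f : I -> V) :
  irreflexive e -> irreflexive (pull e f).
Proof. by move=> es x; exact: es. Qed.

(** Every graph is literally, not only up to isomorphism, the graph of its code: this
makes the type of graphs countable, and lets densities be computed on codes. *)
Lemma graph_of_surj (F : graph) : exists n (H : {set 'I_n.+1 * 'I_n.+1}),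
  H \subset upper_pairs n.+1 /\ F = graph_of H.
Proof.
case: F => [[//|n] n0 e es ei]; exists n, (edge_set e); split; first exact: edge_set_sub.
have eE := edge_setK es ei; rewrite /graph_of.
move: (srel_sym (edge_set e)) (srel_irr (edge_set e)) => h1 h2.
move: h1 h2; rewrite /is_true in n0 *; rewrite eE => h1 h2.
by rewrite (Prop_irrelevance n0 (ltn0Sn n)) (Prop_irrelevance es h1)
  (Prop_irrelevance ei h2).
Qed.

Lemma cvg_sumr (R : realType) (T I : Type) (F : set_system T) {FF : Filter F}
    (r : seq I) (P : pred I) (f : I -> T -> R) (l : I -> R) :
  (forall i, P i -> f i x @[x --> F] --> l i) ->
  \sum_(i <- r | P i) f i x @[x --> F] --> \sum_(i <- r | P i) l i.
Proof. by move=> fl; apply: cvg_big => //; exact: add_continuous. Qed.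

Section Sampling.
Variable R : realType.

Definition sample_mean (G : graph) (Y : finType) (Phi : rel Y -> R) : R :=
  mean (fun f : {ffun Y -> 'I_(gv G)} => Phi (pull (@gedge G) f)).

Lemma hom_density_mean (F G : graph) :
  hom_density R F G = mean (fun f : {ffun 'I_(gv F) -> 'I_(gv G)} =>
    (@is_hom F G f)%:R).
Proof.
rewrite /hom_density /mean -sum1_card natr_sum big_mkcond/=.
congr (_ / _); apply: eq_bigr => f _.
by rewrite -[f \in _]/(@is_hom F G f); case: (@is_hom F G f).
Qed.

Lemma hom_density_graph_of n (H : {set 'I_n.+1 * 'I_n.+1}) G :
  H \subset upper_pairs n.+1 ->
  hom_density R (graph_of H) G =
  sample_mean G (fun e : rel 'I_n.+1 => (H \subset edge_set e)%:R).
Proof.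
move=> Htri; rewrite hom_density_mean; apply: eq_mean => f; congr (_%:R).
congr nat_of_bool.
apply/forallP/fintype.subsetP => [fh [x y] xyH|fh x].
  have xy := fintype.subsetP Htri _ xyH; rewrite inE xy /=.
  move: xy; rewrite inE/= => xy.
  have /forallP/(_ y)/implyP := fh x; apply.
  by rewrite /= /srel xyH andbT neq_ltn xy.
apply/forallP => y; apply/implyP => /andP[_ /orP[/fh|/fh]].
  by rewrite inE => /andP[].
by rewrite inE => /andP[_]; rewrite gedge_sym.
Qed.

(** The probability that a sample of [Gamma] on [n.+1] vertices is the graph coded by
[H], obtained from the containment probabilities by inclusion-exclusion. *)
Definition graph_prob (Gamma : graph -> R) n (H : {set 'I_n.+1 * 'I_n.+1}) : R :=
  \sum_(B : {set 'I_n.+1 * 'I_n.+1} | B \subset upper_pairs n.+1 :\: H)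
    (-1) ^+ #|B| * Gamma (graph_of (H :|: B)).

Definition limit_mean (Gamma : graph -> R) n
    (phi : {set 'I_n.+1 * 'I_n.+1} -> R) : R :=
  \sum_(H : {set 'I_n.+1 * 'I_n.+1} | H \subset upper_pairs n.+1)
    phi H * graph_prob Gamma H.

(** Expands the product, over all pairs [p], of the indicators that the sample agrees
with [H] at [p]. *)
Lemma sample_graph_prob G n (H : {set 'I_n.+1 * 'I_n.+1}) : H \subset upper_pairs n.+1 ->
  graph_prob (fun F => hom_density R F G) H =
  sample_mean G (fun e : rel 'I_n.+1 => (edge_set e == H)%:R).
Proof.
move=> HU.
transitivity (sample_mean G (fun e : rel 'I_n.+1 =>
   \sum_(B : {set 'I_n.+1 * 'I_n.+1} | B \subset upper_pairs n.+1 :\: H)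
    (-1) ^+ #|B| * (H :|: B \subset edge_set e)%:R)).
  rewrite /sample_mean mean_sum; apply: eq_bigr => B BU.
  rewrite meanZ hom_density_graph_of// finset.subUset HU/=.
  by apply: (fintype.subset_trans BU); rewrite finset.subsetDl.
apply: eq_mean => f; set e := pull _ f.
rewrite (eq_bigr (fun B : {set 'I_n.+1 * 'I_n.+1} =>
  (-1) ^+ #|B| * \prod_(p in H :|: B) (p \in edge_set e)%:R)); last first.
  by move=> B _; rewrite prod_bool.
rewrite -prod_if// [LHS](_ : _ =
   \prod_(p in upper_pairs n.+1) ((p \in edge_set e) == (p \in H))%:R); last first.
  apply: eq_bigr => p _; case: ifP => pH; first by rewrite eqb_id.
  by rewrite eqbF_neg; case: (p \in edge_set e); rewrite ?subrr ?subr0.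
rewrite (prod_bool R _ (fun p => (p \in edge_set e) == (p \in H))); congr (_%:R).
congr nat_of_bool; apply/fintype.subsetP/eqP => [eH|-> p _]; last first.
  by rewrite unfold_in eqxx.
apply/finset.setP => p; case: (boolP (p \in upper_pairs n.+1)) => [/eH|pn].
  by rewrite unfold_in => /eqP.
by rewrite (contraNF (fintype.subsetP HU p) pn)
  (contraNF (fintype.subsetP (edge_set_sub e) p) pn).
Qed.

Lemma sample_limit_mean G n (phi : {set 'I_n.+1 * 'I_n.+1} -> R) :
  sample_mean G (fun e : rel 'I_n.+1 => phi (edge_set e)) =
  limit_mean (fun F => hom_density R F G) phi.
Proof.
rewrite /limit_mean (eq_bigr (fun H => sample_mean G
    (fun e : rel 'I_n.+1 => phi H * (edge_set e == H)%:R))); last first.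
  by move=> H HU; rewrite /sample_mean meanZ -/(sample_mean _ _) sample_graph_prob.
rewrite /sample_mean -mean_sum; apply: eq_mean => f.
rewrite (bigD1 (edge_set (pull (@gedge G) f))) ?edge_set_sub//= eqxx mulr1.
rewrite big1 ?addr0// => H /andP[_ /negPf]; rewrite eq_sym => ->.
by rewrite mulr0.
Qed.

(** One spare vertex is added so that the target is never empty; sampling is insensitive
to unused vertices. *)
Definition slot (Y : finType) (y : Y) : 'I_#|Y|.+1 :=
  widen_ord (leqnSn #|Y|) (enum_rank y).

Lemma slot_inj Y : injective (@slot Y).
Proof. by move=> x y [] /val_inj/enum_rank_inj. Qed.

(** The limit of [sample_mean (Gs j) Phi] along any sequence [Gs] converging to [Gamma]
(see [cvg_limit_sample]), written so that it visibly depends on [Gamma] alone. *)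
Definition limit_sample (Gamma : graph -> R) (Y : finType) (Phi : rel Y -> R) : R :=
  limit_mean Gamma (fun H : {set 'I_#|Y|.+1 * 'I_#|Y|.+1} =>
    Phi (pull (srel H) (@slot Y))).
Arguments limit_sample Gamma {Y} Phi.

Lemma sample_limit_sample G (Y : finType) (Phi : rel Y -> R) :
  sample_mean G Phi = limit_sample (fun F => hom_density R F G) Phi.
Proof.
rewrite /limit_sample -sample_limit_mean /sample_mean.
rewrite -(mean_ffun_inj _ _ (@slot_inj Y)); last by rewrite card_ord gv_gt0.
apply: eq_mean => f; congr Phi; rewrite edge_setK; last 2 first.
- exact/pull_sym/gedge_sym.
- exact/pull_irr/gedge_irr.
by apply/funext => x; apply/funext => y; rewrite /pull !ffunE.
Qed.

(** Sampling is consistent: the part of a sample seen through an injection of vertex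
sets is again a sample. *)
Lemma sample_mean_pull G (Y Z : finType) (h : Z -> Y) (Phi : rel Z -> R) : injective h ->
  sample_mean G (fun e : rel Y => Phi (pull e h)) = sample_mean G Phi.
Proof.
move=> hi; rewrite /sample_mean -(mean_ffun_inj _ _ hi) ?card_ord ?gv_gt0//.
apply: eq_mean => f; congr Phi.
by apply/funext => x; apply/funext => y; rewrite /pull !ffunE.
Qed.

Section Limit.
Variables (Gamma : graph -> R) (Gs : nat -> graph).
Hypothesis cvG : forall F, hom_density R F (Gs n) @[n --> \oo] --> Gamma F.

Lemma cvg_limit_mean n (phi : {set 'I_n.+1 * 'I_n.+1} -> R) :
  sample_mean (Gs j) (fun e : rel 'I_n.+1 => phi (edge_set e)) @[j --> \oo] -->
  limit_mean Gamma phi.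
Proof.
under eq_fun do rewrite sample_limit_mean.
apply: cvg_sumr => H _; apply: cvgM; first exact: cvg_cst.
apply: cvg_sumr => B _; apply: cvgM; first exact: cvg_cst.
exact: cvG.
Qed.

Lemma cvg_limit_sample (Y : finType) (Phi : rel Y -> R) :
  sample_mean (Gs j) Phi @[j --> \oo] --> limit_sample Gamma Phi.
Proof.
under eq_fun do rewrite sample_limit_sample.
apply: cvg_sumr => H _; apply: cvgM; first exact: cvg_cst.
apply: cvg_sumr => B _; apply: cvgM; first exact: cvg_cst.
exact: cvG.
Qed.

End Limit.

End Sampling.
Arguments limit_sample {R} Gamma {Y} Phi.
Arguments cvg_limit_sample {R Gamma Gs} cvG {Y} Phi _ _.
Arguments cvg_limit_mean {R Gamma Gs} cvG {n} phi _ _.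

(** * Statistics of a graph at a few marked vertices *)

Section LargeNumbers.
Variable R : realType.

(** A property of finitely many marked vertices [K] in a graph, uniformly in the graph. *)
Definition statistic (K : finType) :=
  forall T : finType, rel T -> (K -> T) -> bool.

(** Preservation by arbitrary homomorphisms, injective or not. It gives at once
invariance under isomorphism and monotonicity in the vertex set. *)
Definition hom_monotone K (psi : statistic K) :=
  forall (T U : finType) (e : rel T) (e' : rel U) (h : T -> U) (v : K -> T),
    (forall x y, e x y -> e' (h x) (h y)) -> psi T e v -> psi U e' (h \o v).

Definition stat_avg K (psi : statistic K) (T : finType) (e : rel T) : R :=
  mean (fun v : {ffun K -> T} => (psi T e v)%:R).

(** The statistic at distinguished vertices [K] of a sample with [m] further vertices;
its probability is what increases with [m]. *)
Definition rooted K (psi : statistic K) m (e : rel (K + 'I_m)%type) : R :=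
  (psi _ e inl)%:R.

(** The second moment of the average of [psi] is the first moment of the average of
this statistic, so that one convergence theorem serves for both. *)
Definition pair_stat K (psi : statistic K) : statistic (K + K)%type :=
  fun T e v => psi T e (v \o inl) && psi T e (v \o inr).

Definition not_injective_fraction (K : finType) n : R :=
  mean (fun v : {ffun K -> 'I_n.+1} => (~~ injectiveb v)%:R).

Lemma pair_stat_monotone K (psi : statistic K) :
  hom_monotone psi -> hom_monotone (pair_stat psi).
Proof.
by move=> hpsi T U e e' h v he /andP[v1 v2]; apply/andP; split;
  rewrite -compA; apply: hpsi he _.
Qed.

Lemma stat_avg_pair K (psi : statistic K) (T : finType) (e : rel T) :
  stat_avg (pair_stat psi) e = stat_avg psi e ^+ 2.
Proof.
rewrite expr2 /stat_avg -mean_ffun_sum; apply: eq_mean => v.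
rewrite -natrM mulnb; congr ((psi T e _ && psi T e _)%:R);
  by apply/funext => i; rewrite ffunE.
Qed.

Lemma stat_avg_ge0 K (psi : statistic K) (T : finType) (e : rel T) :
  0 <= stat_avg psi e.
Proof. exact: mean_ge0. Qed.

Lemma stat_avg_le1 K (psi : statistic K) (T : finType) (e : rel T) :
  stat_avg psi e <= 1.
Proof. by apply: mean_le1 => v; rewrite lern1; case: psi. Qed.

Lemma injection_avoiding (K : finType) m n (v : K -> 'I_n) : (#|K| + m <= n)%N ->
  exists w : 'I_m -> 'I_n, injective w /\ forall i j, v i != w j.
Proof.
move=> Kmn; pose C : {set 'I_n} := [set x | x \notin codom v]%SET.
have mC : (m <= #|C|)%N.
  have -> : C = ~: [set x in codom v]%SET by apply/finset.setP => x; rewrite !inE.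
  rewrite -(leq_add2l #|[set x in codom v]%SET|) cardsC card_ord.
  by apply: leq_trans Kmn; rewrite leq_add2r cardsE leq_image_card.
exists (fun j => enum_val (widen_ord mC j)); split.
  by move=> i j /enum_val_inj [] /val_inj.
move=> i j; apply: contraTneq (enum_valP (widen_ord mC j)) => <-.
by rewrite inE negbK codom_f.
Qed.

Section FiniteGraph.
Variables (K : finType) (psi : statistic K) (hpsi : hom_monotone psi).
Variable G : graph.

Lemma sample_mono (Z Y : finType) (h : Z -> Y) (u : K -> Z) : injective h ->
  sample_mean G (fun e : rel Z => (psi e u)%:R : R) <=
  sample_mean G (fun e : rel Y => (psi e (h \o u))%:R).
Proof.
move=> hi; rewrite -(sample_mean_pull _ _ hi); apply: ler_mean => f.
by rewrite ler_nat; case: (psi _ u) (@hpsi _ _ (pull (pull (@gedge G) f) h)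
  (pull (@gedge G) f) h u) => // ->.
Qed.

(** Separate the marked vertices from all of [Y]: send marked vertices to the roots and
the others to fresh vertices. The map is injective, so the sample on [Y] is seen
inside the rooted one. *)
Lemma sample_le_rooted (Y : finType) (v : K -> Y) : injective v ->
  sample_mean G (fun e : rel Y => (psi e v)%:R : R) <=
  sample_mean G (@rooted K psi #|Y|).
Proof.
move=> vi; pose h y : (K + 'I_#|Y|)%type :=
  if [pick i | v i == y] is Some i then inl i else inr (enum_rank y).
have hv : h \o v = inl.
  apply/funext => i; rewrite /h/=; case: pickP => [j /eqP/vi -> //|/(_ i)].
  by rewrite eqxx.
rewrite /rooted -hv; apply: sample_mono => x y; rewrite /h.
case: pickP => [i /eqP <-|_]; case: pickP => [j /eqP <-|_] //.
  by move=> [->].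
by move=> [] /enum_rank_inj.
Qed.

Lemma rooted_le_sample (Y : finType) (v : K -> Y) m (w : 'I_m -> Y) :
    injective v -> injective w -> (forall i j, v i != w j) ->
  sample_mean G (@rooted K psi m) <=
  sample_mean G (fun e : rel Y => (psi e v)%:R : R).
Proof.
move=> vi wi vw.
pose h (x : (K + 'I_m)%type) := match x with inl i => v i | inr j => w j end.
rewrite (_ : v = h \o inl)//; apply: sample_mono.
move=> [i|i] [j|j] /=; first by move=> /vi ->.
- by move=> /eqP; rewrite (negPf (vw _ _)).
- by move=> /esym/eqP; rewrite (negPf (vw _ _)).
- by move=> /wi ->.
Qed.

Lemma rooted_mono m n : (m <= n)%N ->
  sample_mean G (@rooted K psi m) <= sample_mean G (@rooted K psi n).
Proof.
move=> mn; apply: (@rooted_le_sample _ inl m (inr \o widen_ord mn)) => //.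
- by move=> i j [].
- by move=> i j [] /val_inj.
Qed.

(** For an injective choice of marked vertices this is [sample_le_rooted]; the
non-injective choices are discarded. *)
Lemma sample_avg_le n :
  sample_mean G (fun e : rel 'I_n.+1 => stat_avg psi e) <=
  sample_mean G (@rooted K psi n.+1) + not_injective_fraction K n.
Proof.
rewrite [leLHS]/sample_mean /stat_avg mean_mean.
set s := sample_mean _ _.
apply: (@le_trans _ _ (mean (fun v : {ffun K -> 'I_n.+1} =>
  s + (~~ injectiveb v)%:R))).
  apply: ler_mean => v; have [/injectiveP vi|_] := boolP (injectiveb v).
    by rewrite addr0; have := sample_le_rooted vi; rewrite card_ord.
  rewrite ler_wpDl// ?mean_ge0//; apply: mean_le1 => f.
  by rewrite lern1; case: psi.
rewrite meanD mean_cst// card_ffun card_ord expn_gt0.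
by [].
Qed.

Lemma sample_avg_ge m n : (#|K| + m <= n.+1)%N ->
  sample_mean G (@rooted K psi m) - not_injective_fraction K n <=
  sample_mean G (fun e : rel 'I_n.+1 => stat_avg psi e).
Proof.
move=> Kmn; rewrite [leRHS]/sample_mean /stat_avg mean_mean.
set s := sample_mean _ _.
apply: (@le_trans _ _ (mean (fun v : {ffun K -> 'I_n.+1} =>
  s - (~~ injectiveb v)%:R))); last first.
  apply: ler_mean => v; have [/injectiveP vi|_] := boolP (injectiveb v).
    rewrite subr0; have [w [wi vw]] := injection_avoiding v Kmn.
    exact: (rooted_le_sample vi wi vw).
  apply: (@le_trans _ _ 0); last exact: mean_ge0.
  rewrite subr_le0; apply: mean_le1 => f.
  by rewrite /rooted lern1; case: psi.
by rewrite meanD meanN mean_cst// card_ffun card_ord expn_gt0.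
Qed.

(** The heart of the variance bound. Let [A] and [B] be the two events, and [A'], [B'] the
same events witnessed by two disjoint groups of [m] auxiliary vertices. Then [A'] and
[B'] are independent and [A' -> A], [B' -> B], so that the probability of [A /\ B] is
at most that of [A' /\ B'] plus the two differences. *)
Lemma pair_rooted_le m :
  sample_mean G (@rooted _ (pair_stat psi) (m + m)) <=
  sample_mean G (@rooted K psi m) ^+ 2 +
  2 * (sample_mean G (@rooted K psi #|{: (K + K) + 'I_(m + m)}|) -
       sample_mean G (@rooted K psi m)).
Proof.
pose Y : finType := ((K + K) + 'I_(m + m))%type.
pose v1 (i : K) : Y := inl (inl i).
pose v2 (i : K) : Y := inl (inr i).
pose h1 (x : (K + 'I_m)%type) : Y :=
  match x with inl i => v1 i | inr j => inr (lshift m j) end.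
pose h2 (x : (K + 'I_m)%type) : Y :=
  match x with inl i => v2 i | inr j => inr (rshift m j) end.
have h1i : injective h1.
  by move=> [i|i] [j|j] // []; [move=> -> | move=> /val_inj ->].
have h2i : injective h2.
  by move=> [i|i] [j|j] // []; [move=> -> | move=> /addnI/val_inj ->].
pose h (x : ((K + 'I_m) + (K + 'I_m))%type) : Y :=
  match x with inl i => h1 i | inr j => h2 j end.
have hi : injective h.
  move=> [i|i] [j|j] /=; [by move=> /h1i -> | | | by move=> /h2i ->];
  case: i j => [i|i] [j|j] //= [] ij; have := ltn_ord i; have := ltn_ord j.
  - by rewrite ij; lia.
  - by rewrite -ij; lia.
have A1 e : @psi _ (pull e h1) inl -> @psi Y e v1.
  by apply: (@hpsi _ _ (pull e h1) e h1 inl).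
have A2 e : @psi _ (pull e h2) inl -> @psi Y e v2.
  by apply: (@hpsi _ _ (pull e h2) e h2 inl).
pose s := sample_mean G (@rooted K psi m).
pose b1 e : R := (@psi Y e v1)%:R; pose b2 e : R := (@psi Y e v2)%:R.
pose a1 (e : rel Y) : R := @rooted K psi m (pull e h1).
pose a2 (e : rel Y) : R := @rooted K psi m (pull e h2).
have a1E : sample_mean G a1 = s by exact: sample_mean_pull.
have a2E : sample_mean G a2 = s by exact: sample_mean_pull.
have a12E : sample_mean G (fun e => a1 e * a2 e) = s ^+ 2.
  rewrite expr2 /s /sample_mean -mean_ffun_sum.
  rewrite -(mean_ffun_inj _ _ hi) ?card_ord ?gv_gt0//.
  apply: eq_mean => f; rewrite /a1 /a2; congr (_ * _); apply: f_equal;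
    by apply/funext => x; apply/funext => y; rewrite /pull !ffunE.
have le12 : sample_mean G (@rooted _ (pair_stat psi) (m + m)) <=
   sample_mean G (fun e => a1 e * a2 e + (b1 e + - a1 e) + (b2 e + - a2 e)).
  apply: ler_mean => f; rewrite /rooted /pair_stat /a1 /a2 /b1 /b2 /rooted.
  move: (A1 (pull (@gedge G) f)) (A2 (pull (@gedge G) f)).
  rewrite -[inl \o inl]/v1 -[inl \o inr]/v2.
  by do 4! case: (@psi _ _ _) => //=; move=> ? ?;
    rewrite ?mulr0 ?mulr1 ?subrr ?subr0 ?addr0 ?add0r ?ler01 ?ler1n//;
    try (by exfalso; auto); try lra.
have b1le : sample_mean G b1 <= sample_mean G (@rooted K psi #|Y|).
  by apply: sample_le_rooted => x y [].
have b2le : sample_mean G b2 <= sample_mean G (@rooted K psi #|Y|).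
  by apply: sample_le_rooted => x y [].
apply: (le_trans le12); rewrite -a12E -/s.
move: a1E a2E a12E b1le b2le.
rewrite /sample_mean !meanD !meanN => -> -> _.
rewrite -/(sample_mean G (@rooted K psi #|Y|)); set t := sample_mean _ _.
move=> b1le b2le.
rewrite -addrA lerD2l mulr_natl mulr2n.
by apply: lerD; rewrite lerD2r.
Qed.

End FiniteGraph.
End LargeNumbers.

(** * A law of large numbers for samples of a graph limit *)

Section LimitLargeNumbers.
Variable R : realType.

Lemma not_injective_fractionE (K : finType) n :
  @not_injective_fraction R K n = 1 - (n.+1 ^_ #|K|)%:R / (n.+1 ^ #|K|)%:R.
Proof.
rewrite /not_injective_fraction (eq_mean (g2 := fun v : {ffun K -> 'I_n.+1} =>
  1 + - (injectiveb v)%:R)); last first.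
  by move=> v; case: injectiveb => /=; rewrite ?subrr ?subr0.
rewrite meanD meanN mean_cst; last by rewrite card_ffun card_ord expn_gt0.
congr (1 - _); rewrite /mean card_ffun card_ord; congr (_ / _).
have := card_inj_ffuns K 'I_n.+1; rewrite card_ord => <-.
rewrite -sum1_card natr_sum [RHS]big_mkcond/=.
by apply: eq_bigr => v _; rewrite inE; case: injectiveb.
Qed.

Lemma ffact_ratio_cvg k :
  (n.+1 ^_ k)%:R / (n.+1 ^ k)%:R @[n --> \oo] --> (1 : R).
Proof.
elim: k => [|k IH].
  by under eq_fun do rewrite ffactn0 expn0 divr1; exact: cvg_cst.
have -> : (fun n => (n.+1 ^_ k.+1)%:R / (n.+1 ^ k.+1)%:R : R) =
  (fun n => ((n.+1 ^_ k)%:R / (n.+1 ^ k)%:R) * ((n.+1 - k)%:R / n.+1%:R)).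
  by apply/funext => n; rewrite ffactnSr expnSr !natrM mulf_div.
rewrite -[X in _ --> X]mulr1; apply: cvgM => //.
have c : (fun n => 1 - k%:R * n.+1%:R^-1 : R) @ \oo --> 1 - k%:R * (0 : R).
  apply: cvgB; first exact: cvg_cst.
  by apply: cvgM; [exact: cvg_cst | exact: cvg_harmonic].
rewrite mulr0 subr0 in c; apply: cvg_trans c; apply: near_eq_cvg; near=> n.
have kn : (k <= n.+1)%N by apply: leqW; near: n; exact: nbhs_infty_ge.
by rewrite natrB// mulrBl divff.
Unshelve. all: by end_near. Qed.

Lemma not_injective_fraction_cvg (K : finType) :
  @not_injective_fraction R K n @[n --> \oo] --> 0.
Proof.
under eq_fun do rewrite not_injective_fractionE.
rewrite -(subrr 1); apply: cvgB; first exact: cvg_cst.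
exact: ffact_ratio_cvg.
Qed.

Variables (Gamma : graph -> R) (hG : graph_limit Gamma).

Lemma limit_mean_srel (Gs : nat -> graph)
    (cvG : forall F, hom_density R F (Gs n) @[n --> \oo] --> Gamma F)
    n (Phi : rel 'I_n.+1 -> R) :
  sample_mean (Gs j) Phi @[j --> \oo] -->
  limit_mean Gamma (fun H : {set 'I_n.+1 * 'I_n.+1} => Phi (srel H)).
Proof.
have := cvg_limit_mean cvG (fun H : {set 'I_n.+1 * 'I_n.+1} => Phi (srel H)).
have -> // : (fun j => sample_mean (Gs j) (fun e : rel 'I_n.+1 =>
    Phi (srel (edge_set e)))) =
  (fun j => sample_mean (Gs j) Phi).
apply/funext => j; apply: eq_mean => f; congr Phi; apply: edge_setK.
  exact/pull_sym/gedge_sym.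
exact/pull_irr/gedge_irr.
Qed.

Arguments limit_mean_srel {Gs} cvG {n} Phi _ _.

(** Not visible from the alternating sum, but a limit of genuine probabilities. *)
Lemma graph_prob_ge0 n (H : {set 'I_n.+1 * 'I_n.+1}) : H \subset upper_pairs n.+1 ->
  0 <= graph_prob Gamma H.
Proof.
move=> HU; have [Gs [_ cvG]] := hG.
have := cvg_limit_mean cvG (fun H' : {set 'I_n.+1 * 'I_n.+1} => (H' == H)%:R).
rewrite /limit_mean (bigD1 H)//= eqxx mul1r big1 ?addr0; last first.
  by move=> H' /andP[_ /negPf ->]; rewrite mul0r.
move=> c; apply: (ler_cvg_to (cvg_cst 0) c).
by near=> j; apply: mean_ge0.
Unshelve. all: by end_near. Qed.

Lemma limit_mean_cst n (c : R) :
  limit_mean Gamma (fun _ : {set 'I_n.+1 * 'I_n.+1} => c) = c.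
Proof.
have [Gs [_ cvG]] := hG.
apply: (cvg_unique (@Rhausdorff R) (cvg_limit_mean cvG (fun=> c))).
have -> : (fun j => sample_mean (Gs j) (fun e : rel 'I_n.+1 => c)) = fun=> c.
  apply/funext => j; apply: mean_cst.
  by rewrite card_ffun !card_ord expn_gt0 gv_gt0.
exact: cvg_cst.
Qed.

Section OneStatistic.
Variables (K : finType) (psi : statistic K) (hpsi : hom_monotone psi).

Definition rooted_mean m : R := limit_sample Gamma (@rooted R K psi m).

Definition stat_limit : R := limn rooted_mean.

Lemma rooted_mean_homo m n : (m <= n)%N -> rooted_mean m <= rooted_mean n.
Proof.
move=> mn; have [Gs [_ cvG]] := hG.
apply: (ler_cvg_to (cvg_limit_sample cvG _) (cvg_limit_sample cvG _)).
by near=> j; exact: rooted_mono.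
Unshelve. all: by end_near. Qed.

Lemma rooted_mean_le1 m : rooted_mean m <= 1.
Proof.
have [Gs [_ cvG]] := hG; apply: (ler_cvg_to (cvg_limit_sample cvG _) (cvg_cst (1 : R))).
by near=> j; apply: mean_le1 => f; rewrite /rooted lern1; case: psi.
Unshelve. all: by end_near. Qed.

Lemma stat_limit_cvg : rooted_mean m @[m --> \oo] --> stat_limit.
Proof.
apply: nondecreasing_is_cvgn; first by move=> m n; exact: rooted_mean_homo.
by exists 1 => _ [n _ <-]; exact: rooted_mean_le1.
Qed.

Lemma rooted_mean_le_limit m : rooted_mean m <= stat_limit.
Proof.
apply: (ler_cvg_to (cvg_cst _) stat_limit_cvg).
by near=> n; apply: rooted_mean_homo; near: n; exact: nbhs_infty_ge.
Unshelve. all: by end_near. Qed.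

Definition avg_mean n : R :=
  limit_mean Gamma (fun H : {set 'I_n.+1 * 'I_n.+1} => stat_avg R psi (srel H)).

(** The expected average is squeezed between two rooted probabilities, up to the
probability that the marked vertices collide. *)
Lemma avg_mean_cvg : avg_mean n @[n --> \oo] --> stat_limit.
Proof.
have [Gs [_ cvG]] := hG.
apply: (@squeeze_cvgr _ _ _ _
  (fun n => rooted_mean (n.+1 - #|K|) - @not_injective_fraction R K n)
  (fun n => rooted_mean n.+1 + @not_injective_fraction R K n)).
- near=> n; apply/andP; split.
    apply: (ler_cvg_to (cvgB (cvg_limit_sample cvG _) (cvg_cst _)) (limit_mean_srel cvG _)).
    near=> j; apply: sample_avg_ge => //; rewrite subnKC//.
    by apply: leqW; near: n; exact: nbhs_infty_ge.
  apply: (ler_cvg_to (limit_mean_srel cvG _) (cvgD (cvg_limit_sample cvG _) (cvg_cst _))).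
  by near=> j; exact: sample_avg_le.
- rewrite -[X in _ --> X]subr0; apply: cvgB; last exact: not_injective_fraction_cvg.
  (* The number of vertices left after marking [#|K|] of the [n.+1] tends to infinity. *)
  apply: (cvg_comp (fun n => n.+1 - #|K|)%N _ _ stat_limit_cvg).
  apply/cvgnyPge => A; near=> n; rewrite leq_subRL; last first.
    by apply: leqW; near: n; exact: nbhs_infty_ge.
  by apply: leqW; near: n; exact: nbhs_infty_ge.
- rewrite -[X in _ --> X]addr0; apply: cvgD; last exact: not_injective_fraction_cvg.
  by have := stat_limit_cvg; rewrite -(cvg_shiftS rooted_mean).
Unshelve. all: by end_near. Qed.

End OneStatistic.

(** Asymptotic independence of [psi] at two disjoint groups of marked vertices: let first
the total number of vertices and then the number of auxiliary vertices in
[pair_rooted_le] tend to infinity. *)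
Lemma stat_limit_pair (K : finType) (psi : statistic K) :
  hom_monotone psi -> stat_limit (pair_stat psi) <= stat_limit psi ^+ 2.
Proof.
move=> hpsi; have [Gs [_ cvG]] := hG.
have hp2 := pair_stat_monotone hpsi.
have le m : rooted_mean (pair_stat psi) (m + m) <=
    rooted_mean psi m ^+ 2 + 2 * (stat_limit psi - rooted_mean psi m).
  apply: (@le_trans _ _ (rooted_mean psi m ^+ 2 +
     2 * (rooted_mean psi #|{: (K + K) + 'I_(m + m)}| - rooted_mean psi m))).
    rewrite expr2.
    apply: (ler_cvg_to (cvg_limit_sample cvG _)
      (cvgD (cvgM (cvg_limit_sample cvG _) (cvg_limit_sample cvG _))
       (cvgM (cvg_cst (2 : R)) (cvgB (cvg_limit_sample cvG _) (cvg_limit_sample cvG _))))).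
    by near=> j; have := @pair_rooted_le R _ _ hpsi (Gs j) m; rewrite expr2.
  by rewrite lerD2l ler_pM2l// lerD2r rooted_mean_le_limit.
have c := stat_limit_cvg hpsi.
have -> : stat_limit psi ^+ 2 =
  stat_limit psi * stat_limit psi + 2 * (stat_limit psi - stat_limit psi).
  by rewrite subrr mulr0 addr0.
apply: (ler_cvg_to _ (cvgD (cvgM c c) (cvgM (cvg_cst (2 : R)) (cvgB (cvg_cst _) c)))).
  apply: (cvg_comp (fun m => m + m)%N _ _ (stat_limit_cvg hp2)).
  by apply/cvgnyPge => A; near=> n; rewrite (leq_trans _ (leq_addr _ _))//;
     near: n; exact: nbhs_infty_ge.
by near=> m; have := le m; rewrite expr2.
Unshelve. all: by end_near. Qed.

(** A law of large numbers: the variance is the difference between the limits for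
[pair_stat psi] and the square of the limit for [psi], which is at most zero by
[stat_limit_pair]. *)
Lemma stat_avg_variance (K : finType) (psi : statistic K) :
  hom_monotone psi ->
  limit_mean Gamma (fun H : {set 'I_n.+1 * 'I_n.+1} =>
    (stat_avg R psi (srel H) - stat_limit psi) ^+ 2) @[n --> \oo] --> 0.
Proof.
move=> hpsi; have hp2 := pair_stat_monotone hpsi.
set s := stat_limit psi.
have E n : limit_mean Gamma (fun H : {set 'I_n.+1 * 'I_n.+1} =>
    (stat_avg R psi (srel H) - s) ^+ 2) =
    avg_mean (pair_stat psi) n - 2 * s * avg_mean psi n + s ^+ 2.
  rewrite -[in RHS](limit_mean_cst n (s ^+ 2)) /avg_mean /limit_mean.
  rewrite mulr_sumr -sumrB -big_split/=; apply: eq_bigr => H _.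
  by rewrite stat_avg_pair; ring.
have c : avg_mean (pair_stat psi) n - 2 * s * avg_mean psi n + s ^+ 2
    @[n --> \oo] --> stat_limit (pair_stat psi) - 2 * s * s + s ^+ 2.
  apply: cvgD; last exact: cvg_cst.
  apply: cvgB; first exact: avg_mean_cvg.
  by apply: cvgM; [exact: cvg_cst|exact: avg_mean_cvg].
under eq_fun do rewrite E.
have -> : 0 = stat_limit (pair_stat psi) - 2 * s * s + s ^+ 2 => //.
apply/eqP; rewrite eq_le; apply/andP; split; last first.
  by have := stat_limit_pair hpsi; rewrite -/s => h; lra.
apply: (ler_cvg_to (cvg_cst 0) c); near=> n; rewrite -E.
by apply: sumr_ge0 => H HU; rewrite mulr_ge0 ?sqr_ge0 ?graph_prob_ge0.
Unshelve. all: by end_near. Qed.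

End LimitLargeNumbers.

(** * Component sizes as averages of a statistic *)

(** The vertex [v ord0] serves as a root, so that all vertices are compared with it only. *)
Definition conn_stat k : statistic 'I_k.+1 :=
  fun T e v => [forall i, connect e (v ord0) (v i)].

Lemma connect_hom (T U : finType) (e : rel T) (e' : rel U) (h : T -> U) :
  (forall x y, e x y -> e' (h x) (h y)) ->
  forall x y, connect e x y -> connect e' (h x) (h y).
Proof.
move=> he x y /connectP[p]; elim: p x => [x _ -> //|z p IH x /= /andP[xz zp] yE].
by apply: connect_trans (IH z zp yE); apply: connect1; exact: he.
Qed.

Lemma conn_stat_monotone k : hom_monotone (@conn_stat k).
Proof.
move=> T U e e' h v he /forallP vc; apply/forallP => i /=.
exact: connect_hom he _ _ (vc i).
Qed.

(** The statistic whose average over a graph is the homomorphism density of [F]. *)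
Definition hom_stat (F : graph) : statistic 'I_(gv F) :=
  fun T e v => [forall x, forall y, gedge x y ==> e (v x) (v y)].

Lemma hom_stat_monotone F : hom_monotone (@hom_stat F).
Proof.
move=> T U e e' h v he /forallP vc; apply/forallP => x; apply/forallP => y.
by apply/implyP => xy; apply: he; have /forallP/(_ y)/implyP := vc x; apply.
Qed.

Section LargestComponent.
Variables (T : finType) (e : rel T) (esym : symmetric e).
Let c := largest_component_size e.

Lemma largest_component_attained : (0 < #|T|)%N ->
  exists x, #|connect e x| = c.
Proof.
by move=> T0; have [x xE] := bigop.eq_bigmax (fun x => #|connect e x|) T0; exists x.
Qed.

Lemma leq_largest_component x : (#|connect e x| <= c)%N.
Proof. exact: (bigop.leq_bigmax x). Qed.

Lemma largest_component_le : (c <= #|T|)%N.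
Proof. by apply/bigop.bigmax_leqP => x _; exact: max_card. Qed.

(** All maps into a largest component are counted. *)
Lemma conn_count_ge k : (0 < #|T|)%N ->
  (c ^ k.+1 <= #|[pred v : {ffun 'I_k.+1 -> T} | conn_stat e v]|)%N.
Proof.
move=> T0; case: (largest_component_attained T0) => x xc; rewrite -xc.
rewrite -{1}(card_ord k.+1) -card_ffun_on.
apply: subset_leq_card; apply/fintype.subsetP => v /ffun_onP vx.
rewrite inE; apply/forallP => i.
have cs : connect_sym e by exact: sym_connect_sym.
by rewrite (connect_trans _ (vx i))// cs; exact: vx.
Qed.

(** The first vertex is arbitrary and the [k] others must fall into its component. *)
Lemma conn_count_le k :
  (#|[pred v : {ffun 'I_k.+1 -> T} | conn_stat e v]| <= #|T| * c ^ k)%N.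
Proof.
rewrite -sum1_card (partition_big (fun v : {ffun 'I_k.+1 -> T} => v ord0) xpredT)//=.
rewrite -sum_nat_const; apply: leq_sum => x _.
rewrite sum1_card.
pose F (i : 'I_k.+1) : pred T := if i == ord0 then (pred1 x : pred T) else connect e x.
apply: (@leq_trans #|family F|).
  apply: subset_leq_card; apply/fintype.subsetP => v.
  rewrite !inE => /andP[/forallP vc /eqP v0]; apply/familyP => i.
  rewrite /F; case: eqP => [->|_]; first by rewrite inE v0.
  by rewrite -v0; exact: vc.
rewrite card_family foldrE big_image/= big_ord_recl {1}/F eqxx card1 mul1n.
rewrite -[X in (_ ^ X)%N]card_ord -prod_nat_const; apply: leq_prod => i _.
by rewrite /F /= leq_largest_component.
Qed.

End LargestComponent.

Section ComponentFraction.
Variable R : realType.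

Definition comp_frac (T : finType) (e : rel T) : R :=
  (largest_component_size e)%:R / #|T|%:R.

Lemma comp_frac_ge0 (T : finType) (e : rel T) : 0 <= comp_frac e.
Proof. by rewrite divr_ge0. Qed.

Lemma comp_frac_le1 (T : finType) (e : rel T) : comp_frac e <= 1.
Proof.
rewrite /comp_frac; have [->|T0] := posnP #|T|; first by rewrite invr0 mulr0.
by rewrite ler_pdivrMr ?ltr0n// mul1r ler_nat largest_component_le.
Qed.

Lemma conn_avgE k (T : finType) (e : rel T) :
  stat_avg R (@conn_stat k) e =
  #|[pred v : {ffun 'I_k.+1 -> T} | conn_stat e v]|%:R / (#|T| ^ k.+1)%:R.
Proof.
rewrite /stat_avg /mean card_ffun card_ord; congr (_ / _).
rewrite -sum1_card natr_sum [RHS]big_mkcond/=; apply: eq_bigr => v _.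
by rewrite inE; case: conn_stat.
Qed.

(** The sandwich that transfers laws of large numbers from averages of [conn_stat] to the
size of the largest component. *)
Lemma comp_frac_conn k (T : finType) (e : rel T) : (0 < #|T|)%N ->
  symmetric e ->
  comp_frac e ^+ k.+1 <= stat_avg R (@conn_stat k) e <= comp_frac e ^+ k.
Proof.
move=> T0 es; have NT : (#|T|%:R : R) != 0 by rewrite pnatr_eq0 -lt0n.
rewrite conn_avgE /comp_frac; apply/andP; split.
  rewrite expr_div_n -!natrX ler_wpM2r ?invr_ge0// ler_nat.
  exact: conn_count_ge.
rewrite ler_pdivrMr ?ltr0n ?expn_gt0 ?T0// natrX exprSr mulrA -exprMn divfK//.
by rewrite -natrX -natrM ler_nat mulnC conn_count_le.
Qed.

Lemma hom_densityE (F G : graph) :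
  hom_density R F G = stat_avg R (@hom_stat F) (@gedge G).
Proof. by rewrite hom_density_mean. Qed.

Variables (Gamma : graph -> R) (hG : graph_limit Gamma).

(** The rooted probability does not depend on the number of further vertices. *)
Lemma hom_stat_limit F : stat_limit Gamma (@hom_stat F) = Gamma F.
Proof.
rewrite /stat_limit (_ : rooted_mean _ _ = fun=> Gamma F).
  by apply: lim_cst; exact: Rhausdorff.
apply/funext => m; have [Gs [_ cvG]] := hG.
apply: (cvg_unique (@Rhausdorff R) (cvg_limit_sample cvG _)).
rewrite (_ : (fun j => _) = fun j => hom_density R F (Gs j)); first exact: cvG.
apply/funext => j; rewrite hom_density_mean.
have inli : injective (@inl 'I_(gv F) 'I_m) by move=> x y [].
exact: (sample_mean_pull (Gs j) (fun e : rel 'I_(gv F) => (hom_stat e id)%:R) inli).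
Qed.

Definition conn_limit k : R := stat_limit Gamma (@conn_stat k).

(** Limits of graphs are tested on countably many graphs, which is what allows a single
sequence to be extracted. *)
Definition graph_enum (i : nat) : graph :=
  match unpickle i : option {n & {set 'I_n.+1 * 'I_n.+1}} with
  | Some u => graph_of (projT2 u)
  | None => @graph_of 0 finset.set0
  end.

Lemma graph_enum_surj F : exists i, graph_enum i = F.
Proof.
have [n [H [_ ->]]] := graph_of_surj F.
by exists (pickle (existT (fun n => {set 'I_n.+1 * 'I_n.+1}) n H));
  rewrite /graph_enum pickleK.
Qed.

Lemma limit_mean_min n (f : rel 'I_n.+1 -> R) (eps : R) :
  limit_mean Gamma (fun H : {set 'I_n.+1 * 'I_n.+1} => f (srel H)) < eps ->
  exists H : {set 'I_n.+1 * 'I_n.+1}, f (srel H) < eps.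
Proof.
move=> lt; apply: contrapT => /forallNP ge.
suff : eps <= limit_mean Gamma (fun H : {set 'I_n.+1 * 'I_n.+1} => f (srel H)).
  by rewrite leNgt lt.
rewrite -[leLHS](limit_mean_cst hG n); apply: ler_sum => H HU.
apply: ler_wpM2r; first exact: graph_prob_ge0.
by rewrite leNgt; apply/negP; exact: ge.
Qed.

(** Convergence in mean square of finitely many statistics makes some sample close to the
limit in all of them at once. *)
Lemma sampled_graph (m : nat) (eps : R) : 0 < eps ->
  exists G : graph, [/\ (m <= gv G)%N,
    forall i, (i < m)%N ->
      `|hom_density R (graph_enum i) G - Gamma (graph_enum i)| < eps &
    forall k, (k < m)%N ->
      `|stat_avg R (@conn_stat k) (@gedge G) - conn_limit k| < eps].
Proof.
move=> e0.
(* The total squared deviation of the first [m] statistics of both kinds. *)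
pose D n (e : rel 'I_n.+1) : R :=
  \sum_(i < m) (stat_avg R (@hom_stat (graph_enum i)) e -
                Gamma (graph_enum i)) ^+ 2 +
  \sum_(k < m) (stat_avg R (@conn_stat k) e - conn_limit k) ^+ 2.
have Dcvg : limit_mean Gamma (fun H : {set 'I_n.+1 * 'I_n.+1} => D n (srel H))
    @[n --> \oo] --> 0.
  have -> : (fun n => limit_mean Gamma
      (fun H : {set 'I_n.+1 * 'I_n.+1} => D n (srel H))) = (fun n =>
    \sum_(i < m) limit_mean Gamma (fun H : {set 'I_n.+1 * 'I_n.+1} =>
      (stat_avg R (@hom_stat (graph_enum i)) (srel H) -
       stat_limit Gamma (@hom_stat (graph_enum i))) ^+ 2) +
    \sum_(k < m) limit_mean Gamma (fun H : {set 'I_n.+1 * 'I_n.+1} =>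
      (stat_avg R (@conn_stat k) (srel H) -
       stat_limit Gamma (@conn_stat k)) ^+ 2)).
    apply/funext => n; rewrite /limit_mean [X in _ = X + _]exchange_big/=.
    rewrite [X in _ = _ + X]exchange_big/= -big_split/=; apply: eq_bigr => H _.
    rewrite -!mulr_suml -mulrDl; congr ((_ + _) * _).
    by apply: eq_bigr => i _; rewrite hom_stat_limit.
  rewrite -[X in _ --> X]addr0; apply: cvgD.
    rewrite [X in _ --> X](_ : 0 = \sum_(i < m) 0); last by rewrite big1.
    by apply: cvg_sumr => i _; apply: (stat_avg_variance hG); exact: hom_stat_monotone.
  rewrite [X in _ --> X](_ : 0 = \sum_(i < m) 0); last by rewrite big1.
  by apply: cvg_sumr => i _; apply: (stat_avg_variance hG); exact: conn_stat_monotone.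
have e2 : 0 < eps ^+ 2 by rewrite exprn_gt0.
have [n [mn Dn]] : exists n, (m <= n)%N /\ limit_mean Gamma
    (fun H : {set 'I_n.+1 * 'I_n.+1} => D n (srel H)) < eps ^+ 2.
  near \oo => n; exists n; split; first by near: n; exact: nbhs_infty_ge.
  by near: n; apply: (cvgr_lt _ Dcvg).
have [H DH] := limit_mean_min Dn.
have sq x (S : R) : x ^+ 2 <= S -> S < eps ^+ 2 -> `|x| < eps.
  move=> xS Se; rewrite -(@ltr_pXn2r _ 2)// ?nnegrE ?(ltW e0)//.
  by rewrite real_normK ?num_real// (le_lt_trans xS).
exists (graph_of H); split; first by rewrite /= leqW.
- move=> i im; apply: sq DH; rewrite hom_densityE /D.
  rewrite (bigD1 (Ordinal im))//= -addrA lerDl addr_ge0//;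
    by rewrite sumr_ge0// => j _; rewrite sqr_ge0.
- move=> i im; apply: sq DH; rewrite /D [leRHS]addrC.
  rewrite (bigD1 (Ordinal im))//= -addrA lerDl addr_ge0//;
    by rewrite sumr_ge0// => j _; rewrite sqr_ge0.
Unshelve. all: by end_near. Qed.

(** An arbitrary sequence converging to [Gamma] may have connected members although [Gamma]
is disconnected. The sampled graphs are typical and have the right component sizes. *)
Lemma sampled_sequence : exists Hs : nat -> graph,
  [/\ forall j, (j <= gv (Hs j))%N,
      forall F, hom_density R F (Hs j) @[j --> \oo] --> Gamma F &
      forall k, stat_avg R (@conn_stat k) (@gedge (Hs j)) @[j --> \oo] -->
                conn_limit k].
Proof.
have /choice[Hs HsP] : forall m, exists G : graph, [/\ (m <= gv G)%N,
    forall i, (i < m)%N ->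
      `|hom_density R (graph_enum i) G - Gamma (graph_enum i)| < m.+1%:R^-1 &
    forall k, (k < m)%N ->
      `|stat_avg R (@conn_stat k) (@gedge G) - conn_limit k| < m.+1%:R^-1].
  by move=> m; apply: sampled_graph; rewrite invr_gt0.
exists Hs; split; first by move=> j; have [] := HsP j.
- move=> F; have [i <-] := graph_enum_surj F.
  apply/cvgrPdist_lt => eps e0; near=> j; have [_ + _] := HsP j.
  move=> /(_ i) h; rewrite distrC; apply: lt_trans (h _) _.
    by near: j; exact: nbhs_infty_gt.
  by near: j; exact: near_infty_natSinv_lt (PosNum e0).
- move=> k.
  apply/cvgrPdist_lt => eps e0; near=> j; have [_ _] := HsP j.
  move=> /(_ k) h; rewrite distrC; apply: lt_trans (h _) _.
    by near: j; exact: nbhs_infty_gt.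
  by near: j; exact: near_infty_natSinv_lt (PosNum e0).
Unshelve. all: by end_near. Qed.

End ComponentFraction.

(** * The component density of a graph limit *)

Section Exponents.
Variable R : realType.

(** The gap between the exponents [k] and [k + 1] is negligible for large [k], so that
inequalities up to one power determine a number. *)
Lemma expr_lt_exprS (x y : R) : 0 <= x -> x < y -> exists k, x ^+ k < y ^+ k.+1.
Proof.
move=> x0 xy; have y0 : 0 < y by exact: le_lt_trans xy.
have r1 : `|x / y| < 1.
  by rewrite ger0_norm ?divr_ge0 ?(ltW y0)// ltr_pdivrMr// mul1r.
near \oo => k; exists k.
have : (x / y) ^+ k < y.
  by near: k; apply: (cvgr_lt _ (cvg_expr r1)).
by rewrite expr_div_n ltr_pdivrMr ?exprn_gt0// -exprS.
Unshelve. all: by end_near. Qed.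

Lemma ler_exprS (x y : R) : 0 <= y -> (forall k, x ^+ k.+1 <= y ^+ k) -> x <= y.
Proof.
move=> y0 xy; rewrite leNgt; apply/negP => yx.
have [k] := expr_lt_exprS y0 yx.
by rewrite ltNge xy.
Qed.

Lemma ler_exprS2 (x y : R) : 0 <= y -> 0 <= x <= 1 ->
  (forall k, x ^+ k.+2 <= y ^+ k.+1) -> x <= y.
Proof.
move=> y0 /andP[x0 x1] xy; apply: ler_exprS => // -[|k]; last exact: xy.
by rewrite expr0 expr1.
Qed.

End Exponents.

Section Ultra.
Variable R : realType.

Lemma cvg_exprn (T : Type) (F : set_system T) {FF : Filter F} (u : T -> R) (l : R) k :
  u x @[x --> F] --> l -> u x ^+ k @[x --> F] --> l ^+ k.
Proof.
move=> ul; elim: k => [|k IH]; first by apply: cvg_cst.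
rewrite exprS (_ : (fun x => _) = fun x => u x * u x ^+ k); first exact: cvgM.
by apply/funext => x; rewrite exprS.
Qed.

Lemma ultra_fmap (T V : Type) (U : set_system T) (u : T -> V) :
  UltraFilter U -> UltraFilter (u x @[x --> U]).
Proof.
move=> UU; split; first exact: fmap_proper_filter.
move=> G GG uG; apply/seteqP; split => // A GA.
case: (in_ultra_setVsetC (u @^-1` A) UU) => [//|UC].
have GC : G (~` A) by exact: (uG (~` A) UC).
have /filter_ex[x []//] : G (A `&` ~` A) by exact: filterI.
Qed.

Lemma ultra_cvg (T : Type) (U : set_system T) (u : T -> R) :
  UltraFilter U -> (forall x, 0 <= u x <= 1) ->
  exists2 l : R, 0 <= l <= 1 & u x @[x --> U] --> l.
Proof.
move=> UU u01.
have := @segment_compact R 0 1; rewrite compact_ultra.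
move=> /(_ _ (ultra_fmap u UU)) [|l [l01 ul]].
  have UF : ProperFilter U by exact: ultra_proper.
  suff : U (u @^-1` `[0, 1]) by [].
  by apply: filterE => x; rewrite /= in_itv /= u01.
by exists l => //; move: l01; rewrite /= in_itv.
Qed.

(** Convergence along a filter suffices since only countably many densities have to be
approximated: choose the [m]-th graph correct up to [1 / (m + 1)] on the first [m]. *)
Lemma graph_limit_of_filter (T : Type) (U : set_system T) {UF : ProperFilter U}
    (Gs : T -> graph) (Gamma : graph -> R) :
  (forall N, \forall x \near U, (N <= gv (Gs x))%N) ->
  (forall F, hom_density R F (Gs x) @[x --> U] --> Gamma F) ->
  graph_limit Gamma.
Proof.
move=> gvoo cvG.
have /choice[Hs HsP] : forall m : nat, exists x : T, (m <= gv (Gs x))%N /\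
    forall i : 'I_m, `|hom_density R (graph_enum i) (Gs x) -
       Gamma (graph_enum i)| < m.+1%:R^-1.
  move=> m; apply: (@filter_ex _ U); apply: filterI; first exact: gvoo.
  apply: filter_forall => i; have /cvgrPdist_lt := cvG (graph_enum i).
  have m0 : (0 : R) < m.+1%:R^-1 by rewrite invr_gt0.
  by move=> /(_ _ m0); apply: filterS => x; rewrite distrC.
exists (Gs \o Hs); split.
  apply/cvgnyPge => A; near=> j; have [+ _] := HsP j.
  by apply: leq_trans; near: j; exact: nbhs_infty_ge.
move=> F; have [i <-] := graph_enum_surj F.
apply/cvgrPdist_lt => eps e0; near=> j; have [_ +] := HsP j.
have ij : (i < j)%N by near: j; exact: nbhs_infty_gt.
move=> /(_ (Ordinal ij)) /= h; rewrite distrC; apply: lt_trans h _.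
by near: j; exact: near_infty_natSinv_lt (PosNum e0).
Unshelve. all: by end_near. Qed.

End Ultra.

Section Rho.
Variables (R : realType) (Gamma : graph -> R) (hG : graph_limit Gamma).

(** By [ler_exprS] at most one [rho] has this property. *)
Definition component_density (rho : R) :=
  0 <= rho <= 1 /\
  forall k, rho ^+ k.+1 <= conn_limit Gamma k <= rho ^+ k.

(** An ultrafilter replaces the extraction of subsequences: all bounded quantities converge
along it, among them the fraction of the largest component and, later, the densities of
its two parts. *)
Lemma ultra_sample : exists (U : set_system nat) (Hs : nat -> graph) (rho : R),
  [/\ UltraFilter U,
      forall N, \forall j \near U, (N <= gv (Hs j))%N,
      forall F, hom_density R F (Hs j) @[j --> U] --> Gamma F,
      comp_frac R (@gedge (Hs j)) @[j --> U] --> rho &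
      component_density rho].
Proof.
have [Hs [gvH cvG cvC]] := sampled_sequence hG.
have [U [UU ooU]] := @ultraFilterLemma _ (\oo : set_system nat) _.
have [rho rho01 Zrho] := @ultra_cvg R _ _ (fun j => comp_frac R (@gedge (Hs j))) UU
  (fun j => introT andP (conj (comp_frac_ge0 R _) (comp_frac_le1 R _))).
have UF : ProperFilter U by exact: ultra_proper.
exists U, Hs, rho; split => //.
- move=> N; apply: ooU; near=> j; apply: leq_trans (gvH j).
  by near: j; exact: nbhs_infty_ge.
- by move=> F A /cvG/ooU.
- split=> // k.
  have cU : stat_avg R (@conn_stat k) (@gedge (Hs j)) @[j --> U] -->
    conn_limit Gamma k by move=> A /cvC/ooU.
  have Zk i : comp_frac R (@gedge (Hs j)) ^+ i @[j --> U] --> rho ^+ i.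
    exact: cvg_exprn.
  have Hk j := comp_frac_conn R k (ltac:(by rewrite card_ord gv_gt0) :
    (0 < #|'I_(gv (Hs j))|)%N) (@gedge_sym (Hs j)).
  apply/andP; split.
    by apply: (ler_cvg_to (Zk k.+1) cU); near=> j; have /andP[] := Hk j.
  by apply: (ler_cvg_to cU (Zk k)); near=> j; have /andP[] := Hk j.
Unshelve. all: by end_near. Qed.

(** For [k = 1] the density bounds the probability that two vertices are connected, and
hence that they are adjacent, which bounds [Gamma F] if [F] has an edge. *)
Lemma trivial_of_density0 : component_density 0 -> Gamma = trivial_limit.
Proof.
move=> [_ /(_ 1%N)/andP[_]]; rewrite expr1 => c0.
apply/funext => F; rewrite /trivial_limit; have [Gs [_ cvG]] := hG.
case: eqP => [F0|/eqP]; last rewrite -lt0n => /card_gt0P[[x y]].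
  apply: (cvg_unique (@Rhausdorff R) (cvG F)).
  rewrite (_ : (fun j => _) = fun=> 1); first exact: cvg_cst.
  apply/funext => j; rewrite hom_density_mean (eq_mean (g2 := fun=> 1)).
    by rewrite mean_cst// card_ffun !card_ord expn_gt0 gv_gt0.
  move=> f; rewrite (_ : is_hom f = true)//.
  apply/forallP => x; apply/forallP => y; apply/implyP => xy; exfalso.
  have nedge p : ~~ @edges F p.
    by apply/negP => pF; move/eqP: F0; rewrite /ge -leqn0 leqNgt => /negP; apply;
       apply/card_gt0P; exists p.
  case: (ltngtP x y) => [xy'|xy'|/val_inj xy']; last first.
  - by move: xy; rewrite xy' gedge_irr.
  - by have := nedge (y, x); rewrite /edges/= xy' gedge_sym xy.
  - by have := nedge (x, y); rewrite /edges/= xy' xy.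
rewrite unfold_in => /andP[/= xy exy].
pose w (i : 'I_2) : 'I_(gv F) := if i == ord0 then x else y.
have wi : injective w.
  have nxy : x != y by rewrite neq_ltn xy.
  by move=> i j; rewrite /w; case: eqP => [->|/eqP i0]; case: eqP => [->|/eqP j0] //;
    [move/eqP: nxy|move/esym; move/eqP: nxy|
     move=> _; apply: val_inj; case: i i0 => [[|[]]]// ? _; case: j j0 => [[|[]]]// ? _].
apply/le_anti/andP; split; last first.
  apply: (ler_cvg_to (cvg_cst 0) (cvG F)); near=> j.
  by rewrite hom_density_mean mean_ge0.
apply: le_trans c0.
apply: le_trans (rooted_mean_le_limit hG (@conn_stat_monotone 1) (gv F)).
apply: (ler_cvg_to (cvG F) (cvg_limit_sample cvG _)); near=> j.
have := sample_le_rooted R (@conn_stat_monotone 1) (Gs j) wi.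
rewrite card_ord; apply: le_trans.
rewrite hom_density_mean; apply: ler_mean => f; rewrite ler_nat.
have [fh|//] := boolP (is_hom f).
rewrite (_ : conn_stat _ _ = true)//; apply/forallP => i.
rewrite /w eqxx; case: eqP => _; first exact: connect0.
apply: connect1; rewrite /pull.
by have /forallP/(_ x)/forallP/(_ y)/implyP := fh; apply.
Unshelve. all: by end_near. Qed.

Lemma edges_graph_of n (H : {set 'I_n.+1 * 'I_n.+1}) : H \subset upper_pairs n.+1 ->
  forall p, edges (F := graph_of H) p = (p \in H).
Proof.
move=> HU [x y]; rewrite /edges /= /srel.
apply/andP/idP => [[xy /andP[_ /orP[//|yx]]]|xyH].
  by have := fintype.subsetP HU _ yx; rewrite inE/= ltnNge (ltnW xy).
have := fintype.subsetP HU _ xyH; rewrite inE/= => xy.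
by rewrite xy xyH neq_ltn xy.
Qed.

Lemma graph_prob_trivial n (H : {set 'I_n.+1 * 'I_n.+1}) :
  Gamma = trivial_limit -> H \subset upper_pairs n.+1 ->
  graph_prob Gamma H = (H == finset.set0)%:R.
Proof.
move=> -> HU; have E (X : {set 'I_n.+1 * 'I_n.+1}) : X \subset upper_pairs n.+1 ->
    trivial_limit (graph_of X) = (X == finset.set0)%:R :> R.
  move=> XU; rewrite /trivial_limit /ge (eq_card (B := mem X)); last first.
    by move=> p; rewrite -(edges_graph_of XU).
  by rewrite cards_eq0; case: eqP.
rewrite /graph_prob (bigD1 finset.set0) ?finset.sub0set//= finset.cards0 expr0 mul1r.
rewrite finset.setU0 E// big1 ?addr0// => B /andP[BU B0].
rewrite E; last first.
  by rewrite finset.subUset HU (fintype.subset_trans BU)// finset.subsetDl.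
by rewrite finset.setU_eq0 (negPf B0) andbF mulr0.
Qed.

Lemma limit_mean_trivial n (phi : {set 'I_n.+1 * 'I_n.+1} -> R) :
  Gamma = trivial_limit -> limit_mean Gamma phi = phi finset.set0.
Proof.
move=> G0; rewrite /limit_mean (bigD1 finset.set0) ?finset.sub0set//=.
rewrite graph_prob_trivial ?finset.sub0set// eqxx mulr1 big1 ?addr0// => H /andP[HU H0].
by rewrite graph_prob_trivial// (negPf H0) mulr0.
Qed.

Lemma density_of_trivial rho :
  Gamma = trivial_limit -> component_density rho -> rho = 0.
Proof.
move=> G0 [/andP[r0 _] /(_ 1%N)/andP[+ _]].
rewrite (_ : conn_limit _ _ = 0) => [|]; last first.
  rewrite /conn_limit /stat_limit (_ : rooted_mean _ _ = fun=> 0).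
    by apply: lim_cst; exact: Rhausdorff.
  apply/funext => m; rewrite /rooted_mean /limit_sample limit_mean_trivial//.
  rewrite /rooted (_ : conn_stat _ _ = false)//; apply/negP => /forallP/(_ (lift ord0 ord0)).
  case/connectP => -[|y p] /=; first by move=> _ [].
  by rewrite /pull /srel !inE andbF.
by move=> h; apply/eqP; rewrite -sqrf_eq0 eq_le h sqr_ge0.
Qed.

End Rho.

Section Split.
Variable R : realType.

(** The induced subgraph on [A], relabelled by ordinals; all that is used about it are
its homomorphism numbers. *)
Lemma induced_exists (G : graph) (A : {set 'I_(gv G)}) : (0 < #|A|)%N ->
  exists G' : graph, gv G' = #|A| /\ forall F, #|@is_hom F G'| =
      #|[pred f : {ffun 'I_(gv F) -> 'I_(gv G)} |
         is_hom f && [forall x, f x \in A]]|.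
Proof.
move=> A0.
have es : symmetric (pull (@gedge G) (@enum_val _ (mem A))) by exact/pull_sym/gedge_sym.
have ei : irreflexive (pull (@gedge G) (@enum_val _ (mem A))) by exact/pull_irr/gedge_irr.
exists (Graph A0 es ei); split=> // F.
pose lift (f : {ffun 'I_(gv F) -> 'I_#|A|}) : {ffun 'I_(gv F) -> 'I_(gv G)} :=
  [ffun x => enum_val (f x)].
have lift_inj : injective lift.
  move=> f g /ffunP fg; apply/ffunP => x; have := fg x.
  by rewrite !ffunE => /enum_val_inj.
rewrite -(card_imset _ lift_inj); apply: eq_card => f; rewrite !inE.
apply/imsetP/andP => [[g gh ->]|[fh /forallP fA]].
  split; last by apply/forallP => x; rewrite ffunE enum_valP.
  apply/forallP => x; apply/forallP => y; rewrite !ffunE.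
  by have /forallP/(_ x)/forallP/(_ y) := gh.
exists [ffun x => enum_rank_in (fA x) (f x)]; last first.
  by apply/ffunP => x; rewrite !ffunE enum_rankK_in.
apply/forallP => x; apply/forallP => y; rewrite !ffunE /= /pull !enum_rankK_in//.
by have /forallP/(_ x)/forallP/(_ y) := fh.
Qed.

Lemma hom_closed (F G : graph) (A : {set 'I_(gv G)}) f :
  graph_connected F ->
  (forall x y, gedge x y -> (x \in A) = (y \in A)) ->
  @is_hom F G f -> forall x y, (f x \in A) = (f y \in A).
Proof.
move=> Fc Ac fh x y; have /connectP[p] := Fc x y.
elim: p x => [x _ -> //|z p IH x /= /andP[xz zp] yE].
rewrite -(IH z zp yE); apply: Ac.
by have /forallP/(_ x)/forallP/(_ z)/implyP := fh; apply.
Qed.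

Lemma hom_count_split (F G : graph) (A : {set 'I_(gv G)}) :
  graph_connected F ->
  (forall x y, gedge x y -> (x \in A) = (y \in A)) ->
  #|@is_hom F G| =
    (#|[pred f : {ffun 'I_(gv F) -> 'I_(gv G)} |
         is_hom f && [forall x, f x \in A]]| +
     #|[pred f : {ffun 'I_(gv F) -> 'I_(gv G)} |
         is_hom f && [forall x, f x \in ~: A]]|)%N.
Proof.
move=> Fc Ac; rewrite -cardUI [X in (_ + X)%N](_ : _ = 0%N) ?addn0.
  apply: eq_card => f; rewrite !inE -andb_orr.
  symmetry; apply: andb_idr => fh; apply/orP.
  pose x0 := Ordinal (gv_gt0 F).
  have h x := hom_closed Fc Ac fh x x0.
  have [fA|fA] := boolP (f x0 \in A); [left|right];
    by apply/forallP => x; rewrite ?inE h ?fA.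
apply/eqP; rewrite -leqn0 leqNgt; apply/negP => /card_gt0P[f].
rewrite !inE => /andP[/andP[_ /forallP f1] /andP[_ /forallP f2]].
pose x0 := Ordinal (gv_gt0 F).
by have := f2 x0; rewrite inE f1.
Qed.

(** A connected graph is mapped into the largest component or into its complement. The
condition guarantees that the complement is nonempty. *)
Lemma component_split (G : graph) :
  exists G12 : graph * graph, (comp_frac R (@gedge G) < 1 ->
    [/\ (gv G12.1)%:R = comp_frac R (@gedge G) * (gv G)%:R,
        (gv G12.2)%:R = (1 - comp_frac R (@gedge G)) * (gv G)%:R &
        forall F, graph_connected F ->
          hom_density R F G =
            comp_frac R (@gedge G) ^+ gv F * hom_density R F G12.1 +
            (1 - comp_frac R (@gedge G)) ^+ gv F * hom_density R F G12.2]).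
Proof.
set Z := comp_frac _ _.
have [Z1|_] := boolP (Z < 1); last by exists (G, G).
have n0 : (0 < #|'I_(gv G)|)%N by rewrite card_ord gv_gt0.
have NT : (gv G)%:R != 0 :> R by rewrite pnatr_eq0 -lt0n gv_gt0.
have [x xc] := largest_component_attained (@gedge G) n0.
pose A : {set 'I_(gv G)} := [set y | connect (@gedge G) x y]%SET.
have cA : #|A| = largest_component_size (@gedge G) by rewrite -xc cardsE.
have AZ : #|A|%:R = Z * (gv G)%:R :> R.
  by rewrite /Z /comp_frac cA card_ord divfK.
have A0 : (0 < #|A|)%N by apply/card_gt0P; exists x; rewrite inE connect0.
have cAC : #|~: A| = (gv G - #|A|)%N by rewrite finset.cardsCs finset.setCK card_ord.
have AG : (#|A| < gv G)%N.
  by rewrite -(ltr_nat R) AZ gtr_pMl// ltr0n gv_gt0.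
have AC0 : (0 < #|~: A|)%N by rewrite cAC subn_gt0.
have ACZ : #|~: A|%:R = (1 - Z) * (gv G)%:R :> R.
  by rewrite cAC natrB ?(ltnW AG)// AZ mulrBl mul1r.
have Ac y z : gedge y z -> (y \in A) = (z \in A).
  move=> yz; rewrite !inE.
  have cs : connect_sym (@gedge G) by apply: sym_connect_sym; exact: gedge_sym.
  by rewrite (same_connect_r cs (connect1 yz)).
have [G1 [v1 h1]] := induced_exists A0.
have [G2 [v2 h2]] := induced_exists AC0.
exists (G1, G2) => _; rewrite /= v1 v2; split=> // F Fc.
rewrite /hom_density (hom_count_split Fc Ac) -h1 -h2 !card_ffun !card_ord.
move: #|@is_hom F G1| #|@is_hom F G2| => a b.
rewrite v1 v2 !natrX AZ ACZ natrD.
have Z0 : Z != 0.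
  by apply: contraTneq A0 => Z0; rewrite -(ltr_nat R) AZ Z0 mul0r ltxx.
have Z10 : 1 - Z != 0 by rewrite subr_eq0 eq_sym lt_eqF.
clearbody Z; rewrite !exprMn mulrDl.
have scale (c N y : R) : c != 0 -> y / N = c * (y / (c * N)).
  by move=> c0; rewrite invfM mulrCA mulVKf.
by congr (_ + _); apply: scale; exact: expf_neq0.
Qed.

End Split.

(** * Connected graph limits have component density one *)

Section Connected.
Variable R : realType.

(** Replaces the series over extended reals by its two terms. *)
Lemma is_direct_sum2E (a : R) (Gamma1 Gamma2 Gamma : graph -> R) :
  is_direct_sum2 a Gamma1 Gamma2 Gamma <->
  forall F, graph_connected F -> (1 <= ge F)%N ->
    Gamma F = a ^+ gv F * Gamma1 F + (1 - a) ^+ gv F * Gamma2 F.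
Proof.
have E F : (\sum_(i <oo | below (Some 2%N) i)
    (((if i == 0%N then a else 1 - a) ^+ gv F *
      (if i == 0%N then Gamma1 else Gamma2) F)%:E) =
    (a ^+ gv F * Gamma1 F + (1 - a) ^+ gv F * Gamma2 F)%:E)%E.
  apply/cvg_lim => //.
  pose v := (a ^+ gv F * Gamma1 F + (1 - a) ^+ gv F * Gamma2 F)%:E.
  rewrite -/v.
  have c : (fun _ : nat => v) @ \oo --> v by exact: cvg_cst.
  apply: cvg_trans c; apply: near_eq_cvg; near=> n.
  have n2 : (2 <= n)%N by near: n; exact: nbhs_infty_ge.
  rewrite -(big_nat_widen 0 2 n xpredT) => //.
  by rewrite !big_nat_recr //= big_nil add0e /v EFinD.
split=> h F Fc F1; last by rewrite E h.
by have := h F Fc F1; rewrite E => -[].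
Unshelve. all: by end_near. Qed.

Variables (Gamma : graph -> R) (hG : graph_limit Gamma).

Lemma trivial_disconnected : Gamma = trivial_limit -> limit_disconnected Gamma.
Proof.
move=> G0; exists Gamma, Gamma, 2^-1; split => //; first by lra.
apply/is_direct_sum2E => F _ F1.
by rewrite G0 /trivial_limit gtn_eqF// !mulr0 addr0.
Qed.

(** If the density is neither zero nor one, the limits of the largest component and of the
rest form a decomposition. *)
Lemma connected_density1 :
  exists rho, component_density Gamma rho /\ (limit_connected Gamma -> rho = 1).
Proof.
have [U [Hs [rho [UU gvoo cvG cvZ cd]]]] := ultra_sample hG.
exists rho; split=> // Gconn; have UF : ProperFilter U by exact: ultra_proper.
have [/andP[r0 r1] _] := cd.
apply/eqP; rewrite eq_le r1 leNgt; apply/negP => rlt1; apply: Gconn.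
have [r0' |rpos] := eqVneq rho 0.
  by apply: trivial_disconnected; apply: trivial_of_density0 => //; rewrite -r0'.
have {}rpos : 0 < rho by rewrite lt_def rpos.
have /choice[G12 G12P] := fun j => component_split R (Hs j).
have lim_dens (Gs : nat -> graph) : exists Gam : graph -> R,
    forall F, hom_density R F (Gs j) @[j --> U] --> Gam F.
  have /choice[Gam GamP] : forall F, exists l : R,
      hom_density R F (Gs j) @[j --> U] --> l.
    move=> F; have [|l _ lP] := @ultra_cvg R _ _ (fun j => hom_density R F (Gs j)) UU.
      by move=> j; rewrite hom_densityE stat_avg_ge0 stat_avg_le1.
    by exists l.
  by exists Gam.
have [Gam1 cv1] := lim_dens (fun j => (G12 j).1).
have [Gam2 cv2] := lim_dens (fun j => (G12 j).2).
have Zlt1 : \forall j \near U, comp_frac R (@gedge (Hs j)) < 1.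
  exact: (cvgr_lt _ cvZ).
have grow (a : R) (Gs : nat -> graph) (x : nat -> R) : 0 < a ->
    x j @[j --> U] --> a ->
    (\forall j \near U, (gv (Gs j))%:R = x j * (gv (Hs j))%:R) ->
    forall N, \forall j \near U, (N <= gv (Gs j))%N.
  move=> a0 xa gvE N.
  have xa2 : \forall j \near U, a / 2 < x j by apply: (cvgr_gt _ xa); lra.
  (* Once [x j > a / 2], it suffices that [gv (Hs j)] exceeds [2 * N / a]. *)
  pose M := Num.bound (N%:R / (a / 2)).
  near=> j; have gE : (gv (Gs j))%:R = x j * (gv (Hs j))%:R by near: j.
  rewrite -(ler_nat R) gE.
  have xj : a / 2 < x j by near: j.
  have gM : (M <= gv (Hs j))%N by near: j; exact: gvoo.
  have a2 : 0 < a / 2 by lra.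
  apply: (@le_trans _ _ (a / 2 * M%:R)).
    rewrite mulrC -ler_pdivrMr//; apply/ltW; apply: archi_boundP.
    by rewrite divr_ge0// ltW.
  apply: ler_pM => //; [exact: ltW|exact: ltW|by rewrite ler_nat].
exists Gam1, Gam2, rho; split.
- apply: (graph_limit_of_filter _ cv1).
  apply: (grow _ _ _ rpos cvZ); apply: filterS Zlt1 => j Zj.
  by have [] := G12P j Zj.
- apply: (graph_limit_of_filter _ cv2).
  apply: (grow (1 - rho) _ (fun j => 1 - comp_frac R (@gedge (Hs j)))).
  + by rewrite subr_gt0.
  + by apply: cvgB => //; exact: cvg_cst.
  + by apply: filterS Zlt1 => j Zj; have [] := G12P j Zj.
- by rewrite rpos rlt1.
- apply/is_direct_sum2E => F Fc _.
  have c : comp_frac R (@gedge (Hs j)) ^+ gv F * hom_density R F (G12 j).1 +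
      (1 - comp_frac R (@gedge (Hs j))) ^+ gv F * hom_density R F (G12 j).2
      @[j --> U] --> rho ^+ gv F * Gam1 F + (1 - rho) ^+ gv F * Gam2 F.
    apply: cvgD; apply: cvgM => //; apply: cvg_exprn => //.
    by apply: cvgB => //; exact: cvg_cst.
  apply: (cvg_unique (@Rhausdorff R) (cvG F)).
  apply: cvg_trans c; apply: near_eq_cvg.
  by apply: filterS Zlt1 => j Zj; have [_ _ ->] := G12P j Zj.
Unshelve. all: by end_near. Qed.

End Connected.

(** * Inclusion-exclusion for connectedness *)

Section InclusionExclusion.
Variables (Y : finType) (r : Y) (K : finType) (v : K -> Y).

Definition pair_rel (F : {set Y * Y}) : rel Y :=
  fun x y => (x != y) && (((x, y) \in F) || ((y, x) \in F)).

Lemma pair_rel_sym F : symmetric (pair_rel F).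
Proof. by move=> x y; rewrite /pair_rel eq_sym orbC. Qed.

Lemma pair_rel_irr F : irreflexive (pair_rel F).
Proof. by move=> x; rewrite /pair_rel eqxx. Qed.

Definition root_comp (F : {set Y * Y}) : {set Y} :=
  [set x | connect (pair_rel F) r x]%SET.

Definition rel_set (e : rel Y) : {set Y * Y} := [set p | e p.1 p.2]%SET.

(** A minimal witness for connection need not be connected as a graph on [Y], because of
isolated vertices; here all edges lie in the component of the root, and this
component contains the points [v i]. *)
Definition linking (F : {set Y * Y}) : bool :=
  [forall p in F, [&& p.1 != p.2, p.1 \in root_comp F & p.2 \in root_comp F]] &&
  [forall i, v i \in root_comp F].

Definition linked (e : rel Y) : bool := [forall i, connect e r (v i)].

(** If the points are connected, all edges in the component of the root form a witness. *)
Lemma linkedP (e : rel Y) : symmetric e -> irreflexive e ->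
  reflect (exists2 F, linking F & F \subset rel_set e) (linked e).
Proof.
move=> es ei; apply: (iffP idP) => [/forallP le|[F /andP[_ /forallP vF] Fe]].
  pose F : {set Y * Y} := [set p | e p.1 p.2 && connect e r p.1]%SET.
  have Fconn x : connect e r x -> x \in root_comp F.
    move=> /connectP[p]; rewrite -(cats0 p) inE; elim/last_ind: p x => [|p z IH] x.
      by move=> _ ->; exact: connect0.
    rewrite cats0 rcons_path last_rcons => /andP[rp pz] ->.
    have rl := IH _ (etrans (congr1 _ (cats0 p)) rp) (esym (congr1 _ (cats0 p))).
    apply: connect_trans (rl) (connect1 _).
    have nz : last r p != z by apply/eqP => E; rewrite E ei in pz.
    rewrite /pair_rel nz !inE /= pz /=.
    by rewrite (_ : connect e r (last r p))//; apply/connectP; exists p.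
  exists F; last by apply/fintype.subsetP => p; rewrite !inE => /andP[].
  apply/andP; split; last by apply/forallP => i; exact: Fconn.
  apply/forallP => -[x y]; apply/implyP; rewrite inE /= => /andP[xy rx].
  rewrite (Fconn _ rx) (Fconn y) ?(connect_trans rx) ?connect1//.
  by rewrite !andbT; apply/eqP => E; rewrite E ei in xy.
apply/forallP => i; have := vF i; rewrite inE; apply: connect_sub => x y.
rewrite /pair_rel => /andP[_ /orP[]] /(fintype.subsetP Fe); rewrite inE /= => exy;
  by apply: connect1; rewrite // es.
Qed.

Lemma root_comp_mono (F F' : {set Y * Y}) :
  F \subset F' -> root_comp F \subset root_comp F'.
Proof.
move=> /fintype.subsetP FF; apply/fintype.subsetP => x; rewrite !inE.
apply: connect_sub => y z /andP[yz /orP[]] /FF yzF; apply: connect1;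
  by rewrite /pair_rel yz yzF ?orbT.
Qed.

(** Linking sets share the root, so their unions are linking. This closure makes
inclusion-exclusion involve connected graphs only. *)
Lemma linking_cover (C : {set {set Y * Y}}) : C != finset.set0 ->
  (forall F, F \in C -> linking F) -> linking (finset.cover C).
Proof.
move=> /finset.set0Pn[F0 F0C] CL.
have sub F : F \in C -> root_comp F \subset root_comp (finset.cover C).
  by move=> FC; apply: root_comp_mono; exact: finset.bigcup_sup.
apply/andP; split.
  apply/forallP => p; apply/implyP => /bigcupP[F FC pF].
  have /andP[/forallP/(_ p)/implyP/(_ pF)/and3P[p12 p1 p2] _] := CL _ FC.
  by rewrite p12 !(fintype.subsetP (sub F FC)).
apply/forallP => i; apply: (fintype.subsetP (sub F0 F0C)).
by have /andP[_ /forallP] := CL _ F0C; apply.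
Qed.

(** The index set of the inclusion-exclusion formula for the union of the events that a
linking set is present. *)
Definition families : pred {set {set Y * Y}} :=
  fun C => (C \subset linking) && (C != finset.set0).

(** One minus the indicator of the union is the product over linking sets of one minus
their indicators. *)
Lemma linked_incl_excl (R : realType) (e : rel Y) :
  symmetric e -> irreflexive e ->
  (linked e)%:R = - \sum_(C : {set {set Y * Y}} | families C)
     (-1) ^+ #|C| * (finset.cover C \subset rel_set e)%:R :> R.
Proof.
move=> es ei.
pose L : {set {set Y * Y}} := [set F | linking F]%SET.
have := prod_1sub L (fun F => (F \subset rel_set e)%:R : R).
rewrite [X in _ = X -> _](bigD1 finset.set0) ?finset.sub0set//=.
rewrite finset.cards0 expr0 mul1r finset.big_set0.
have -> : \prod_(F in L) (1 - (F \subset rel_set e)%:R) = 1 - (linked e)%:R :> R.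
  case: (linkedP es ei) => [[F FL Fe]|nF].
    by rewrite (bigD1 F) ?inE//= Fe /= !mulr1n subrr mul0r.
  rewrite subr0 big1// => F; rewrite inE => FL.
  by case: (boolP (F \subset _)) => [Fe|_]; [exfalso; apply: nF; exists F|rewrite subr0].
move=> /addrI E; rewrite -[LHS]opprK E; congr (- _); apply: eq_big => C.
  congr (_ && _); apply: eq_subset_r => F; by rewrite inE.
move=> _; congr (_ * _); rewrite prod_bool; congr ((nat_of_bool _)%:R).
apply/fintype.subsetP/bigcupsP => h F FC; first by have := h F FC; rewrite unfold_in.
by rewrite unfold_in; exact: h.
Qed.

Lemma root_in F : r \in root_comp F.
Proof. by rewrite inE connect0. Qed.

Lemma root_comp_gt0 F : (0 < #|root_comp F|)%N.
Proof. by apply/card_gt0P; exists r; exact: root_in. Qed.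

(** Isolated vertices do not contribute to densities, so the graph is restricted to the
component of the root, where it is connected. *)
Definition comp_graph (F : {set Y * Y}) : graph :=
  Graph (root_comp_gt0 F)
    (@pull_sym _ _ _ (@enum_val _ (mem (root_comp F))) (@pair_rel_sym F))
    (@pull_irr _ _ _ (@enum_val _ (mem (root_comp F))) (@pair_rel_irr F)).

Lemma comp_graph_connected F : graph_connected (comp_graph F).
Proof.
pose rk0 : 'I_(gv (comp_graph F)) := enum_rank_in (root_in F) r.
pose rk x : 'I_(gv (comp_graph F)) := enum_rank_in (root_in F) x.
have walk p z : z \in root_comp F -> connect (@gedge (comp_graph F)) rk0 (rk z) ->
    path (pair_rel F) z p -> connect (@gedge (comp_graph F)) rk0 (rk (last z p)).
  elim: p z => [//|w p IH] z zF rz /= /andP[zw wp].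
  have wF : w \in root_comp F.
    by move: zF; rewrite !inE => zF; apply: connect_trans (connect1 zw).
  apply: IH => //; apply: connect_trans rz (connect1 _).
  by rewrite /= /pull !enum_rankK_in.
have rconn x : connect (@gedge (comp_graph F)) rk0 x.
  have := enum_valP x; rewrite inE => /connectP[p rp xE].
  rewrite -[x](enum_valK_in (root_in F)) xE.
  by apply: walk rp; [exact: root_in|exact: connect0].
move=> x y; apply: connect_trans (rconn y).
by rewrite (sym_connect_sym (@gedge_sym _)).
Qed.

(** Excludes the one-point graph, to which the defining equation of direct sums does not
apply. *)
Lemma comp_graph_edge F (i : K) : linking F -> v i != r -> (1 <= ge (comp_graph F))%N.
Proof.
move=> /andP[_ /forallP/(_ i) viF] vr; apply/card_gt0P.
have [[x y] xy] : exists p : 'I_(gv (comp_graph F)) * 'I_(gv (comp_graph F)),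
    gedge p.1 p.2.
  have := @comp_graph_connected F (enum_rank_in (root_in F) r)
     (enum_rank_in (root_in F) (v i)).
  case/connectP => -[|z p] /=.
    move=> _ /(congr1 enum_val); rewrite !enum_rankK_in ?root_in// => E.
    by rewrite E eqxx in vr.
  by case/andP => h _ _; exists (enum_rank_in (root_in F) r, z).
rewrite /= in xy; case: (ltngtP x y) => [lt|lt|/val_inj E].
- by exists (x, y); rewrite unfold_in /= lt.
- by exists (y, x); rewrite unfold_in /= lt /pull pair_rel_sym.
- by move: xy; rewrite E /pull pair_rel_irr.
Qed.

Lemma sample_comp_graph (R : realType) F G : linking F ->
  sample_mean G (fun e : rel Y => (F \subset rel_set e)%:R) =
  hom_density R (comp_graph F) G.
Proof.
move=> /andP[/forallP FL _]; rewrite hom_density_mean.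
have := sample_mean_pull G (fun e : rel 'I_(gv (comp_graph F)) =>
  (hom_stat (F := comp_graph F) e id)%:R : R)
  (@enum_val_inj _ (mem (root_comp F))).
rewrite [in RHS]/sample_mean => <-.
apply: eq_mean => f; congr ((nat_of_bool _)%:R).
apply/fintype.subsetP/forallP => [Ff x|h [x y] xyF].
  apply/forallP => y; apply/implyP => /andP[_ /orP[]] /Ff; rewrite inE //=.
  by rewrite /pull gedge_sym.
have /implyP/(_ xyF)/and3P[/= nxy xF yF] := FL (x, y).
have /forallP/(_ (enum_rank_in (root_in F) y))/implyP := h (enum_rank_in (root_in F) x).
rewrite inE /= /pull !enum_rankK_in//; apply.
by rewrite /pair_rel nxy xyF.
Qed.

End InclusionExclusion.

(** * Diluted samples *)

Section BernoulliSubset.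
Variables (R : realType) (m : nat) (a : R).

(** The probability that a random subset, containing each point independently with
probability [a], equals [A]. *)
Definition bernoulli_weight (A : {set 'I_m}) : R :=
  \prod_(j < m) (if j \in A then a else 1 - a).

Lemma bernoulli_weight_ge0 A : 0 <= a <= 1 -> 0 <= bernoulli_weight A.
Proof.
by move=> /andP[a0 a1]; apply: prodr_ge0 => j _; case: ifP; rewrite ?subr_ge0.
Qed.

Lemma bernoulli_weight_sup (J : {set 'I_m}) :
  \sum_(A : {set 'I_m}) (J \subset A)%:R * bernoulli_weight A = a ^+ #|J|.
Proof.
(* Points of [J] are forced to be chosen. *)
transitivity (\prod_(j < m) (a + (if j \in J then 0 else 1 - a))).
  rewrite bigA_distr; apply: eq_bigr => A _.
  case: (boolP (J \subset A)) => [/fintype.subsetP JA|/fintype.subsetPn[j jJ jA]].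
    rewrite mul1r; apply: eq_bigr => j _; case: ifPn => // jA.
    by case: ifP => // /JA; rewrite (negPf jA).
  by rewrite mul0r (bigD1 j)//= (negPf jA) jJ mul0r.
rewrite -prodr_const [RHS]big_mkcond/=; apply: eq_bigr => j _.
by case: ifP => _; rewrite ?addr0// addrC subrK.
Qed.

Lemma bernoulli_weight_sum : \sum_(A : {set 'I_m}) bernoulli_weight A = 1.
Proof.
rewrite -[RHS](expr0 a) -(finset.cards0 'I_m) -bernoulli_weight_sup.
by apply: eq_bigr => A _; rewrite finset.sub0set mul1r.
Qed.

(** Markov's inequality for [2 ^ (n - #|A|)]. *)
Lemma bernoulli_weight_small n : 0 <= a <= 1 ->
  \sum_(A : {set 'I_m}) (#|A| < n)%N%:R * bernoulli_weight A <=
  2 ^+ n * (1 - a / 2) ^+ m.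
Proof.
move=> a01.
have -> : (1 - a / 2) ^+ m = \prod_(j < m) (a / 2 + (1 - a)).
  by rewrite prodr_const card_ord; congr (_ ^+ _); field.
rewrite bigA_distr mulr_sumr; apply: ler_sum => A _.
have -> : \prod_(j < m) (if j \in A then a / 2 else 1 - a) =
   2 ^- #|A| * bernoulli_weight A.
  rewrite -exprVn -prodr_const [X in _ = X * _]big_mkcond/= -big_split/=.
  apply: eq_bigr => j _.
  by case: ifP => _; rewrite ?mul1r// mulrC.
rewrite mulrA; apply: ler_wpM2r; first exact: bernoulli_weight_ge0.
case: (ltnP #|A| n) => [An|_]; last by rewrite divr_ge0// exprn_ge0.
by rewrite ler_pdivlMr ?exprn_gt0// mul1r ler_weXn2l ?ler1n// ltnW.
Qed.

End BernoulliSubset.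

Section Dilution.
Variables (R : realType) (k m : nat).

Let Y : finType := ('I_k.+2 + 'I_m)%type.
Let r : Y := inl ord0.
Let v : 'I_k.+2 -> Y := inl.

(** Each connected graph [F] is weighted by [a ^ v(F)]; with [a = 1] this is the
inclusion-exclusion formula for the probability of connection ([dilution1]), and
[dilution_sample] interprets it for other [a]. *)
Definition dilution (Gamma : graph -> R) (a : R) : R :=
  - \sum_(C : {set {set Y * Y}} | families r v C)
     (-1) ^+ #|C| * (a ^+ gv (comp_graph r (finset.cover C)) *
                     Gamma (comp_graph r (finset.cover C))).

Lemma family_linking C : families r v C -> linking r v (finset.cover C).
Proof.
move=> /andP[/fintype.subsetP CL C0]; exact: linking_cover.
Qed.

Lemma rooted_conn_linked (e : rel Y) :
  rooted R (@conn_stat k.+1) e = (linked r v e)%:R.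
Proof. by []. Qed.

Lemma dilution1 (Gamma : graph -> R) : graph_limit Gamma ->
  rooted_mean Gamma (@conn_stat k.+1) m = dilution Gamma 1.
Proof.
move=> [Gs [_ cvG]]; apply: (cvg_unique (@Rhausdorff R) (cvg_limit_sample cvG _)).
have -> : (fun j => sample_mean (Gs j) (rooted R (@conn_stat k.+1) (m := m))) =
  (fun j => - \sum_(C : {set {set Y * Y}} | families r v C)
     (-1) ^+ #|C| * hom_density R (comp_graph r (finset.cover C)) (Gs j)).
  apply/funext => j; rewrite -(eq_bigr _ (fun C FC => congr1 _
    (sample_comp_graph R (Gs j) (family_linking FC)))).
  rewrite /sample_mean (eq_bigr _ (fun C _ => esym (meanZ _ _))) -mean_sum -meanN.
  apply: eq_mean => f; rewrite rooted_conn_linked linked_incl_excl//.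
    exact/pull_sym/gedge_sym.
  exact/pull_irr/gedge_irr.
apply: cvgN; apply: cvg_sumr => C _; rewrite expr1n mul1r.
by apply: cvgM; [exact: cvg_cst|exact: cvG].
Qed.

Definition inside (A : {set 'I_m}) (x : Y) : bool :=
  if x is inr j then j \in A else true.

Definition restrict (A : {set 'I_m}) (e : rel Y) : rel Y :=
  fun x y => [&& e x y, inside A x & inside A y].

Lemma restrict_sym A e : symmetric e -> symmetric (restrict A e).
Proof. by move=> es x y; rewrite /restrict es andbA andbAC -andbA. Qed.

Lemma restrict_irr A e : irreflexive e -> irreflexive (restrict A e).
Proof. by move=> ei x; rewrite /restrict ei. Qed.

Definition reached (F : {set Y * Y}) : {set 'I_m} :=
  [set j | inr j \in root_comp r F]%SET.

(** For a linking set the endpoints of its edges, together with the root, are exactly the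
component of the root. *)
Lemma linking_restrict F A e : linking r v F ->
  (F \subset rel_set (restrict A e)) =
  (F \subset rel_set e) && (reached F \subset A).
Proof.
move=> /andP[/forallP FL _].
have inF x y : (x, y) \in F -> (x \in root_comp r F) && (y \in root_comp r F).
  by move=> xyF; have /implyP/(_ xyF)/and3P[_ -> ->] := FL (x, y).
apply/fintype.subsetP/andP => [Fe|[/fintype.subsetP Fe /fintype.subsetP RA] [x y] xyF].
  split; first by apply/fintype.subsetP => p /Fe; rewrite !inE => /and3P[].
  apply/fintype.subsetP => j.
  rewrite !inE => /connectP[p]; case/lastP: p => [_|p x]; first by discriminate.
  rewrite rcons_path last_rcons => /andP[_ xF] xE; move: xF; rewrite -xE.
  by case/andP=> _ /orP[] /Fe; rewrite inE /= => /and3P[].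
have := Fe _ xyF; rewrite !inE /restrict /= => ->.
have /andP[xF yF] := inF x y xyF.
by apply/and3P; split=> //; [case: x xF {xyF}|case: y yF {xyF}] => // j jF;
  apply: RA; rewrite inE.
Qed.

Lemma card_root_comp F : linking r v F ->
  #|root_comp r F| = (k.+2 + #|reached F|)%N.
Proof.
move=> /andP[_ /forallP vF].
have -> : root_comp r F = v @: [set: 'I_k.+2]%SET :|: inr @: reached F.
  apply/finset.setP => x; rewrite finset.in_setU; case: x => [i|j].
    rewrite vF; symmetry; apply/orP; left; apply/imsetP.
    by exists i => //; rewrite finset.in_setT.
  apply/idP/orP => [jF|[/imsetP[]//|/imsetP[j' + [->]]]]; last by rewrite inE.
  by right; apply/imsetP; exists j => //; rewrite inE.
rewrite cardsU (_ : _ :&: _ = finset.set0).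
  rewrite finset.cards0 subn0 !card_imset ?finset.cardsT ?card_ord//.
    by move=> i j [].
  by move=> i j [].
apply/finset.setP => x; rewrite !inE; apply/negP => /andP[].
by move=> /imsetP[i _ ->] /imsetP[].
Qed.

(** The factor [a ^ v(F)] is the probability that all vertices of [F] survive an
independent deletion with survival probability [a]. So the diluted sum is the
probability that the marked vertices survive and are connected through survivors. *)
Lemma dilution_sample G (a : R) :
  dilution (fun F => hom_density R F G) a =
  \sum_(A : {set 'I_m}) a ^+ k.+2 * bernoulli_weight a A *
    sample_mean G (fun e : rel Y => (linked r v (restrict A e))%:R).
Proof.
have E A : sample_mean G (fun e : rel Y => (linked r v (restrict A e))%:R) =
    - \sum_(C : {set {set Y * Y}} | families r v C) (-1) ^+ #|C| *
      ((reached (finset.cover C) \subset A)%:R *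
       hom_density R (comp_graph r (finset.cover C)) G).
  rewrite (eq_bigr (fun C : {set {set Y * Y}} => sample_mean G (fun e : rel Y =>
    (-1) ^+ #|C| * ((reached (finset.cover C) \subset A)%:R *
    (finset.cover C \subset rel_set e)%:R)))); last first.
    by move=> C FC; rewrite /sample_mean !meanZ -(sample_comp_graph R G (family_linking FC)).
  rewrite /sample_mean -mean_sum -meanN; apply: eq_mean => f.
  rewrite linked_incl_excl; last 2 first.
  - exact/restrict_sym/pull_sym/gedge_sym.
  - exact/restrict_irr/pull_irr/gedge_irr.
  congr (- _); apply: eq_bigr => C FC; congr (_ * _).
  by rewrite linking_restrict ?family_linking// -natrM mulnb andbC.
rewrite (eq_bigr _ (fun A _ => congr1 _ (E A))) /dilution.
under [RHS]eq_bigr do rewrite mulrN mulr_sumr.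
rewrite sumrN exchange_big/=; congr (- _); apply: eq_bigr => C FC.
rewrite card_root_comp ?family_linking// exprD -bernoulli_weight_sup.
move: (a ^+ k.+2) ((-1) ^+ #|C|) (hom_density _ _ _) => x s h.
rewrite mulr_sumr mulr_suml mulr_sumr; apply: eq_bigr => A _.
by ring.
Qed.

Lemma dilution_sample_ge0 G (a : R) : 0 <= a <= 1 ->
  0 <= dilution (fun F => hom_density R F G) a.
Proof.
move=> a01; rewrite dilution_sample; apply: sumr_ge0 => A _.
apply: mulr_ge0; last exact: mean_ge0.
by apply: mulr_ge0; [apply: exprn_ge0; case/andP: a01|exact: bernoulli_weight_ge0].
Qed.

Lemma dilution_sample_le G (a : R) : 0 <= a <= 1 ->
  dilution (fun F => hom_density R F G) a <= a ^+ k.+2.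
Proof.
move=> a01; rewrite dilution_sample.
rewrite -[leRHS]mulr1 -[X in _ <= _ * X](bernoulli_weight_sum m a) mulr_sumr.
apply: ler_sum => A _; apply: ler_piMr; last by apply: mean_le1 => f; rewrite lern1; case: linked.
by apply: mulr_ge0; [apply: exprn_ge0; case/andP: a01|exact: bernoulli_weight_ge0].
Qed.

(** With high probability at least [n] of the further vertices survive, and [n] of them
already provide connections with the probability of a rooted sample. *)
Lemma dilution_sample_ge G (a : R) n : 0 <= a <= 1 ->
  a ^+ k.+2 * (1 - 2 ^+ n * (1 - a / 2) ^+ m) *
    sample_mean G (rooted R (@conn_stat k.+1) (m := n)) <=
  dilution (fun F => hom_density R F G) a.
Proof.
move=> a01; rewrite dilution_sample; set s := sample_mean _ _.
have s0 : 0 <= s by exact: mean_ge0.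
have a0 : 0 <= a ^+ k.+2 by rewrite exprn_ge0//; case/andP: a01.
apply: (@le_trans _ _ (\sum_(A : {set 'I_m})
   a ^+ k.+2 * ((1 - (#|A| < n)%N%:R) * bernoulli_weight a A) * s)).
  rewrite -mulr_suml -mulr_sumr; apply: ler_wpM2r => //; apply: ler_wpM2l => //.
  under eq_bigr do rewrite mulrBl mul1r.
  rewrite sumrB bernoulli_weight_sum lerD2l lerN2.
  exact: bernoulli_weight_small.
apply: ler_sum => A _; rewrite -[leLHS]mulrA -[leRHS]mulrA; apply: ler_wpM2l => //.
rewrite [_ * bernoulli_weight _ _]mulrC -mulrA.
apply: ler_wpM2l; first exact: bernoulli_weight_ge0.
case: (ltnP #|A| n) => [_|nA]; first by rewrite subrr mul0r mean_ge0.
rewrite subr0 mul1r.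
pose h (x : ('I_k.+2 + 'I_n)%type) : Y :=
  match x with inl i => inl i | inr j => inr (enum_val (widen_ord nA j)) end.
have hi : injective h.
  by move=> [i|i] [j|j] //= []; [move=> -> | move=> /enum_val_inj [] /val_inj ->].
rewrite /s -(sample_mean_pull G _ hi); apply: ler_mean => f; rewrite ler_nat.
have hA x : inside A (h x).
  by case: x => // j; rewrite /inside /=; exact: enum_valP.
set e := pull _ f.
have := @conn_stat_monotone k.+1 _ _ (pull e h) (restrict A e) h inl.
rewrite /rooted; case: (conn_stat _ _) => // mono.
rewrite (_ : linked _ _ _ = true)//; apply: mono => // x y xy.
by rewrite /restrict !hA andbT andbT.
Qed.

End Dilution.

(** * Connection probabilities of a direct sum *)

Section DilutionLimit.
Variables (R : realType) (Gamma : graph -> R) (hG : graph_limit Gamma).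
Variables (k : nat) (a : R) (a01 : 0 <= a <= 1).

Lemma cvg_dilution m (Gs : nat -> graph) :
  (forall F, hom_density R F (Gs j) @[j --> \oo] --> Gamma F) ->
  dilution k m (fun F => hom_density R F (Gs j)) a @[j --> \oo] -->
  dilution k m Gamma a.
Proof.
move=> cvG; apply: cvgN; apply: cvg_sumr => C _.
apply: cvgM; first exact: cvg_cst.
by apply: cvgM; [exact: cvg_cst|exact: cvG].
Qed.

Lemma dilution_ge0 m : 0 <= dilution k m Gamma a.
Proof.
have [Gs [_ cvG]] := hG; apply: (ler_cvg_to (cvg_cst 0) (cvg_dilution cvG)).
by near=> j; exact: dilution_sample_ge0.
Unshelve. all: by end_near. Qed.

Lemma dilution_le m : dilution k m Gamma a <= a ^+ k.+2.
Proof.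
have [Gs [_ cvG]] := hG; apply: (ler_cvg_to (cvg_dilution cvG) (cvg_cst _)).
by near=> j; exact: dilution_sample_le.
Unshelve. all: by end_near. Qed.

Lemma dilution_ge m n :
  a ^+ k.+2 * (1 - 2 ^+ n * (1 - a / 2) ^+ m) *
    rooted_mean Gamma (@conn_stat k.+1) n <= dilution k m Gamma a.
Proof.
have [Gs [_ cvG]] := hG.
apply: (ler_cvg_to (cvgM (cvg_cst _) (cvg_limit_sample cvG _)) (cvg_dilution cvG)).
by near=> j; exact: dilution_sample_ge.
Unshelve. all: by end_near. Qed.

End DilutionLimit.

Section DirectSum.
Variables (R : realType) (M : option nat) (alpha : nat -> R).
Variables (Gammas : nat -> graph -> R) (Gamma : graph -> R).
Hypotheses (hG : graph_limit Gamma)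
  (hGs : forall i, below M i -> graph_limit (Gammas i))
  (hw : weights M alpha) (hs : is_direct_sum M alpha Gammas Gamma).

(** The series over [below M] is turned into an ordinary series; vanishing weights
contribute nothing because the exponents [gv F] are positive. *)
Definition weight i : R := if below M i then alpha i else 0.

Lemma weight_ge0 i : 0 <= weight i.
Proof. by rewrite /weight; case: ifP => // iM; case: hw => + _; apply. Qed.

Lemma weight_sum_le1 n : \sum_(i < n) weight i <= 1.
Proof.
have [a0 a1] := hw; rewrite -lee_fin; apply: le_trans a1.
rewrite -(big_mkord xpredT weight) -sumEFin.
rewrite /weight (eq_bigr (fun i => if below M i then (alpha i)%:E else 0%E)); last first.
  by move=> i _; case: ifP.
rewrite -big_mkcond/=; apply: nneseries_lim_ge => i _ /a0.
by rewrite lee_fin.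
Qed.

Lemma weight_le1 i : weight i <= 1.
Proof.
apply: le_trans (weight_sum_le1 i.+1).
by rewrite big_ord_recr/= lerDr sumr_ge0// => j _; exact: weight_ge0.
Qed.

Lemma weight01 i : 0 <= weight i <= 1.
Proof. by rewrite weight_ge0 weight_le1. Qed.

Lemma direct_sum_cvg F : graph_connected F -> (1 <= ge F)%N ->
  \sum_(i < n) weight i ^+ gv F * Gammas i F @[n --> \oo] --> Gamma F.
Proof.
move=> Fc F1; have Fs := hs Fc F1.
have G0 i : below M i -> (0 <= (alpha i ^+ gv F * Gammas i F)%:E)%E.
  move=> iM; rewrite lee_fin mulr_ge0 ?exprn_ge0//; first by case: hw => + _; apply.
  have [Gs [_ cvG]] := hGs iM; apply: (ler_cvg_to (cvg_cst 0) (cvG F)).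
  by near=> j; rewrite hom_densityE stat_avg_ge0.
have c : (\sum_(0 <= i < n | below M i) (alpha i ^+ gv F * Gammas i F)%:E)%E
    @[n --> \oo] --> (Gamma F)%:E.
  rewrite Fs; apply: is_cvg_nneseries_cond => i _ /G0//.
have E : fine \o (fun n => (\sum_(0 <= i < n | below M i)
    (alpha i ^+ gv F * Gammas i F)%:E)%E) =
    fun n => \sum_(i < n) weight i ^+ gv F * Gammas i F.
  apply/funext => n /=; rewrite big_mkcond/=.
  rewrite -(big_mkord xpredT (fun i => weight i ^+ gv F * Gammas i F)).
  rewrite (eq_bigr (fun i => (weight i ^+ gv F * Gammas i F)%:E)) ?sumEFin//.
  move=> i _; rewrite /weight; case: ifP => // _.
  by rewrite expr0n gtn_eqF ?gv_gt0// mul0r.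
by rewrite -E; exact: fine_cvg c.
Unshelve. all: by end_near. Qed.

(** The finite inclusion-exclusion sum involves connected graphs only, so the defining
equation of the direct sum applies to every term. *)
Lemma rooted_direct_sum k m :
  \sum_(i < n) dilution k m (Gammas i) (weight i) @[n --> \oo] -->
  rooted_mean Gamma (@conn_stat k.+1) m.
Proof.
rewrite dilution1//.
have -> : (fun n => \sum_(i < n) dilution k m (Gammas i) (weight i)) =
  (fun n => - \sum_(C | families (inl ord0 : 'I_k.+2 + 'I_m) inl C)
     (-1) ^+ #|C| * \sum_(i < n) weight i ^+ gv (comp_graph (inl ord0) (finset.cover C)) *
         Gammas i (comp_graph (inl ord0) (finset.cover C))).
  apply/funext => n; rewrite /dilution sumrN exchange_big/=; congr (- _).
  by apply: eq_bigr => C _; rewrite mulr_sumr.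
apply: cvgN; apply: cvg_sumr => C FC; rewrite expr1n mul1r.
apply: cvgM; first exact: cvg_cst.
apply: direct_sum_cvg; first exact: comp_graph_connected.
by apply: (@comp_graph_edge _ _ _ inl _ ord_max); [exact: family_linking|].
Qed.

Lemma dilution_weight0 k m i : ~~ below M i ->
  dilution k m (Gammas i) (weight i) = 0.
Proof.
move=> iM; rewrite /dilution /weight (negPf iM) big1 ?oppr0// => C _.
by rewrite expr0n gtn_eqF ?gv_gt0// mul0r mulr0.
Qed.

Lemma dilution_weight_bounds k m i :
  0 <= dilution k m (Gammas i) (weight i) <= weight i ^+ k.+2.
Proof.
have [iM|iM] := boolP (below M i).
  by rewrite dilution_ge0 ?dilution_le ?weight01//; exact: hGs.
by rewrite dilution_weight0// lexx exprn_ge0// weight_ge0.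
Qed.

Lemma conn_limit_le k (B : R) :
  (forall n, \sum_(i < n) weight i ^+ k.+2 <= B) -> conn_limit Gamma k.+1 <= B.
Proof.
move=> sB.
apply: (ler_cvg_to (stat_limit_cvg hG (@conn_stat_monotone k.+1)) (cvg_cst _)).
near=> m; apply: (ler_cvg_to (@rooted_direct_sum k m) (cvg_cst _)).
near=> n; apply: le_trans (sB n); apply: ler_sum => i _.
by have /andP[] := dilution_weight_bounds k m i.
Unshelve. all: by end_near. Qed.

(** Only the contribution of [Gammas i] is kept; the number [m] of vertices tends to infinity
before the number [n] of survivors. *)
Lemma conn_limit_ge k i : below M i -> 0 < alpha i ->
  weight i ^+ k.+2 * conn_limit (Gammas i) k.+1 <= conn_limit Gamma k.+1.
Proof.
move=> iM ai; have wi : 0 < weight i by rewrite /weight iM.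
have hi := hGs iM.
apply: (ler_cvg_to (cvgM (cvg_cst _) (stat_limit_cvg hi (@conn_stat_monotone k.+1)))
  (cvg_cst _)).
near=> n.
have c : weight i ^+ k.+2 * (1 - 2 ^+ n * (1 - weight i / 2) ^+ m) *
    rooted_mean (Gammas i) (@conn_stat k.+1) n @[m --> \oo] -->
    weight i ^+ k.+2 * (1 - 2 ^+ n * 0) * rooted_mean (Gammas i) (@conn_stat k.+1) n.
  apply: cvgM; last exact: cvg_cst.
  apply: cvgM; first exact: cvg_cst.
  apply: cvgB; first exact: cvg_cst.
  apply: cvgM; first exact: cvg_cst.
  apply: cvg_expr; have := weight_le1 i.
  by rewrite ltr_norml => w1; apply/andP; split; lra.
rewrite mulr0 subr0 mulr1 in c.
apply: (ler_cvg_to c (stat_limit_cvg hG (@conn_stat_monotone k.+1))).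
near=> m; apply: le_trans (dilution_ge hi k (weight01 i) m n) _.
apply: (ler_cvg_to (cvg_cst _) (@rooted_direct_sum k m)).
near=> N; have iN : (i < N)%N by near: N; exact: nbhs_infty_gt.
rewrite (bigD1 (Ordinal iN))//= lerDl sumr_ge0// => j _.
by have /andP[] := dilution_weight_bounds k m j.
Unshelve. all: by end_near. Qed.

End DirectSum.

(** * The component density of a direct sum *)

Section DensityOfSums.
Variables (R : realType) (Gamma : graph -> R) (hG : graph_limit Gamma).
Variables (rho : R) (hrho : component_density Gamma rho).

Lemma density_ge0 : 0 <= rho.
Proof. by have [/andP[]] := hrho. Qed.

Lemma density_le1 : rho <= 1.
Proof. by have [/andP[]] := hrho. Qed.

Lemma density_le (B : R) : 0 <= B ->
  (forall k, conn_limit Gamma k.+1 <= B ^+ k.+1) -> rho <= B.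
Proof.
move=> B0 cB; apply: ler_exprS2 => // [|k]; first exact: hrho.1.
by apply: le_trans (cB k); have /andP[] := hrho.2 k.+1.
Qed.

(** Two random vertices fall into different summands with probability [2 * a * (1 - a)]. *)
Lemma density_lt1_of_disconnected : limit_disconnected Gamma -> rho < 1.
Proof.
move=> [Gamma1 [Gamma2 [a [h1 h2 /andP[a0 a1] hs]]]].
set al := (fun i => if i == 0%N then a else 1 - a) in hs.
have hGs i : below (Some 2%N) i -> graph_limit (if i == 0%N then Gamma1 else Gamma2).
  by case: eqP.
have al0 i : 0 <= al i by rewrite /al; case: eqP => _; lra.
have two (f : nat -> R) n : (forall i, 0 <= f i) ->
    \sum_(0 <= i < n | (i < 2)%N) f i <= f 0%N + f 1%N.
  move=> f0; apply: (@le_trans _ _ (\sum_(0 <= i < maxn n 2 | (i < 2)%N) f i)).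
    rewrite [leRHS](@big_cat_nat _ _ _ n)//= ?leq_maxl//.
    by rewrite lerDl sumr_ge0.
  rewrite -(big_nat_widen 0 2 _ xpredT) ?leq_maxr//.
  by rewrite !big_nat_recr//= big_nil add0r.
have hw : weights (Some 2%N) al.
  split=> [i _|]; first exact: al0.
  apply: lime_le.
    by apply: is_cvg_nneseries_cond => i _ _; rewrite lee_fin.
  near=> n; rewrite sumEFin lee_fin; apply: le_trans (two _ _ al0) _.
  by rewrite /al/=; lra.
have c1 : conn_limit Gamma 1 <= a ^+ 2 + (1 - a) ^+ 2.
  apply: (conn_limit_le hG hGs hw hs) => n.
  rewrite -(big_mkord xpredT (fun i => weight (Some 2%N) al i ^+ 2)).
  apply: le_trans (two (fun i => al i ^+ 2) n _) => [|i]; last exact: sqr_ge0.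
  rewrite [leRHS]big_mkcond/=; apply: ler_sum => i _.
  by rewrite /weight /=; case: ifP => // _; rewrite expr0n.
have := hrho.2 1%N => /andP[r2 _].
have : rho ^+ 2 < 1.
  apply: le_lt_trans r2 _; apply: le_lt_trans c1 _.
  by have : 0 < a * (1 - a) by [apply: mulr_gt0 => //; rewrite subr_gt0]; nra.
by have := density_ge0; have := density_le1; nra.
Unshelve. all: by end_near. Qed.

(** Since the components are connected, [weight i ^ (k + 2) <= conn_limit Gamma (k + 1)],
and this limit is at most the sum of all [weight i ^ (k + 2)], hence at most the
largest weight to the power [k + 1]. Comparing with the powers of [rho] leaves only one
value. The largest weight is attained because the weights tend to zero. *)
Lemma density_is_max_weight M (alpha : nat -> R) Gammas :
  component_decomposition M alpha Gammas Gamma -> is_max_weight M alpha rho.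
Proof.
move=> [comp hw hs].
have hGs i : below M i -> graph_limit (Gammas i) by case/comp.
pose w := weight M alpha.
have w01 i : 0 <= w i <= 1 by exact: weight01.
have conn1 i k : below M i -> conn_limit (Gammas i) k = 1.
  move=> iM; have [hi ci _] := comp i iM.
  have [r [hr r1]] := connected_density1 hi.
  have := hr.2 k; rewrite (r1 ci) !expr1n => /andP[le1 le2].
  by apply/eqP; rewrite eq_le le1 le2.
have le_rho i : below M i -> w i <= rho.
  move=> iM; have [_ _ ai] := comp i iM.
  apply: ler_exprS2 => //; first exact: density_ge0.
  move=> k; have := conn_limit_ge hG hGs hw hs k iM ai.
  rewrite conn1// mulr1 => h; apply: le_trans h _.
  by have /andP[] := hrho.2 k.+1.
have rho_le B : 0 <= B -> (forall i, w i <= B) -> rho <= B.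
  move=> B0 wB; apply: density_le => // k.
  apply: (conn_limit_le hG hGs hw hs) => n.
  apply: (@le_trans _ _ (B ^+ k.+1 * \sum_(i < n) w i)).
    rewrite mulr_sumr; apply: ler_sum => i _; rewrite exprSr.
    apply: ler_wpM2r; first by case/andP: (w01 i).
    by rewrite lerXn2r ?nnegrE//; case/andP: (w01 i).
  by rewrite ler_piMr ?exprn_ge0// weight_sum_le1.
rewrite /is_max_weight; case: eqP => [M0|/eqP M0].
  apply/eqP; rewrite eq_le density_ge0 andbT; apply: rho_le => // i.
  by rewrite /w /weight M0.
have M00 : below M 0 by case: (M) M0 => [[]|].
have [_ _ a0] := comp 0%N M00.
have w0 : 0 < w 0%N by rewrite /w /weight M00.
(* The maximum is attained among the indices below some [N], as later weights are smaller
   than the first. *)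
have wcvg : w n @[n --> \oo] --> 0.
  have : cvgn (series w).
    apply: nondecreasing_is_cvgn.
      apply/nondecreasing_seqP => n; rewrite /series/= big_nat_recr//= lerDl.
      by case/andP: (w01 n).
    exists 1 => _ [n _ <-]; rewrite /series/= big_mkord.
    exact: weight_sum_le1 hw n.
  exact: cvg_series_cvg_0.
have [N _ NP] := cvgr_lt _ wcvg _ w0.
have N0 : (0 < N)%N.
  by rewrite lt0n; apply/eqP => N0; have := NP 0%N; rewrite /= N0 ltxx => /(_ isT).
have [i0 _ i0max] := @arg_maxP _ _ _ (Ordinal N0) xpredT (fun i : 'I_N => w i) isT.
have wmax j : w j <= w i0.
  have [jN|Nj] := ltnP j N; first exact: (i0max (Ordinal jN)).
  by apply: (le_trans (ltW (NP j Nj))); exact: (i0max (Ordinal N0)).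
have i0M : below M i0.
  apply: contraT => nM; have := wmax 0%N.
  by rewrite {2}/w /weight (negPf nM) leNgt w0.
have rE : rho = w i0.
  apply/eqP; rewrite eq_le le_rho// andbT; apply: rho_le => //.
  by case/andP: (w01 i0).
have wE i : below M i -> w i = alpha i by rewrite /w /weight => ->.
split; first by exists i0 => //; rewrite rE wE.
by move=> i iM; rewrite -wE// le_rho.
Qed.

End DensityOfSums.

(** * Integrals of independent variables as iterated integrals *)

Section PowerMeasure.
Variables (R : realType) (d : measure_display) (S : measurableType d).
Variable mu : probability S R.

Definition box n (A : 'I_n -> set S) : set (n.-tuple S) :=
  [set t | forall i, A i (tnth t i)].

Lemma box_bigcap n (A : 'I_n -> set S) :
  box A = \bigcap_(i in [set: 'I_n]) ((@tnth n S ^~ i) @^-1` A i).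
Proof. by apply/seteqP; split=> [t h i _|t h i]; [exact: h|exact: (h i)]. Qed.

Lemma measurable_box n (A : 'I_n -> set S) :
  (forall i, measurable (A i)) -> measurable (box A).
Proof.
move=> mA; rewrite box_bigcap; apply: fin_bigcap_measurable => // i _.
by rewrite -[X in measurable X]setTI; apply: measurable_tnth.
Qed.

Definition cons_pair n (p : S * n.-tuple S) : n.+1.-tuple S := cons_tuple p.1 p.2.

Lemma measurable_cons_pair n : measurable_fun [set: S * n.-tuple S] (@cons_pair n).
Proof. exact: measurable_cons. Qed.

Lemma box_cons n (A : 'I_n.+1 -> set S) :
  @cons_pair n @^-1` box A = A ord0 `*` box (fun i => A (lift ord0 i)).
Proof.
apply/seteqP; split=> [[x t] h|[x t] [hx ht] i] /=.
  split=> [|i]; first by have := h ord0; rewrite /= tnth0.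
  by have := h (lift ord0 i); rewrite /= tnthS.
case: (unliftP ord0 i) => [j ->|->]; last by rewrite tnth0.
by rewrite tnthS; exact: ht.
Qed.

(** The iterated integral is integration against the power measure, built by adjoining one
coordinate at a time. *)
Lemma power_measure n : exists nu : probability (n.-tuple S) R,
  (forall A : 'I_n -> set S, (forall i, measurable (A i)) ->
    nu (box A) = (\prod_(i < n) mu (A i))%E) /\
  (forall f : n.-tuple S -> \bar R, measurable_fun [set: n.-tuple S] f ->
    (forall t, (0 <= f t)%E) -> (\int[nu]_t f t)%E = power_integral mu f).
Proof.
elim: n => [|n [nu [nuA nuf]]].
  exists (\d_ [tuple] : probability _ R); split => [A mA|f mf f0].
    by rewrite big_ord0 /= diracE mem_set//= => -[].
  by rewrite integral_dirac//= diracE mem_set// mul1e.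
pose X : {mfun (S * n.-tuple S)%type >-> n.+1.-tuple S} :=
  HB.pack (@cons_pair n) (isMeasurableFun.Build _ _ _ _ _ (@measurable_cons_pair n)).
exists (distribution ((mu \x nu)%E : probability _ R) X); split=> [A mA|f mf f0].
  rewrite /distribution/= /pushforward box_cons product_measure1E//; last first.
    exact: measurable_box.
  by rewrite big_ord_recl; congr (_ * _)%E; exact: nuA.
rewrite ge0_integral_distribution// fubini_tonelli1//=; last first.
  by apply: measurableT_comp => //; exact: measurable_cons_pair.
apply: eq_integral => x _; rewrite /fubini_F /= nuf//.
apply: measurableT_comp mf _; apply: measurable_cons => //.
exact: measurable_id.
Qed.

(** Boxes form a system stable under intersection that generates the product algebra. *)
Lemma tuple_measure_unique n (m1 m2 : {measure set (n.-tuple S) -> \bar R}) :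
  (m1 [set: n.-tuple S] < +oo)%E ->
  (forall A : 'I_n -> set S, (forall i, measurable (A i)) ->
     m1 (box A) = m2 (box A)) ->
  forall B, measurable B -> m1 B = m2 B.
Proof.
move=> fin1 m12.
pose Bx : set (set (n.-tuple S)) :=
  [set B | exists2 A : 'I_n -> set S, (forall i, measurable (A i)) & B = box A].
have setTBx : Bx setT.
  by exists (fun=> setT) => //; apply/seteqP; split.
apply: (measure_unique Bx (fun=> setT)) => //.
- apply/seteqP; split; last first.
    apply: smallest_sub; first exact: sigma_algebra_measurable.
    by move=> _ [A mA ->]; exact: measurable_box.
  apply: smallest_sub; first exact: smallest_sigma_algebra.
  rewrite -bigcup_seq => B /= [i _ [C mC <-]].
  apply: sub_sigma_algebra; exists (fun j => if j == i then C else setT).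
    by move=> j; case: eqP.
  apply/seteqP; split=> t /=.
    by move=> [_ Ct] j; case: eqP => // ->.
  by move=> h; split=> //; have := h i; rewrite eqxx.
- move=> _ _ [A mA ->] [A' mA' ->]; exists (fun i => A i `&` A' i).
    by move=> i; exact: measurableI.
  apply/seteqP; split=> t /=; first by move=> [h h'] i; split.
  by move=> h; split=> i; have [] := h i.
- by rewrite bigcup_const.
- by move=> _ [A mA ->]; exact: m12.
Qed.

(** The joint law of independent variables agrees with the power measure on boxes. *)
Lemma iid_integral (d' : measure_display) (Omega : measurableType d')
    (P : probability Omega R) (X : nat -> Omega -> S) n
    (f : n.-tuple S -> \bar R) :
  iid P mu X -> measurable_fun [set: n.-tuple S] f -> (forall t, (0 <= f t)%E) ->
  (\int[P]_w f [tuple X i w | i < n])%E = power_integral mu f.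
Proof.
move=> [mX indX] mf f0; have [nu [nuA <-//]] := power_measure n.
pose T w := [tuple X i w | i < n].
have mT : measurable_fun [set: Omega] T.
  apply/measurable_fun_tnthP => i.
  rewrite (_ : _ \o _ = X i)//; apply/funext => w /=.
  by rewrite tnth_mktuple.
pose Tm : {mfun Omega >-> n.-tuple S} :=
  HB.pack T (isMeasurableFun.Build _ _ _ _ _ mT).
transitivity (\int[distribution P Tm]_t f t)%E.
  by rewrite ge0_integral_distribution.
apply: eq_measure_integral => B mB _.
apply: (@tuple_measure_unique n (distribution P Tm) nu) => //.
  by apply: le_lt_trans (ltry 1); exact: probability_le1.
move=> A mA; transitivity (\prod_(i < n) mu (A i))%E; last exact/esym/nuA.
rewrite -indX//; congr (P _).
by apply/seteqP; split=> w h i; have := h i; rewrite /= tnth_mktuple.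
Qed.

End PowerMeasure.

(** * The random graph *)

Section RandomGraphLaw.
Variables (R : realType) (Gamma : graph -> R).
Variables (d : measure_display) (Omega : measurableType d) (P : probability Omega R).

Section Kernel.
Variables (d' : measure_display) (S : measurableType d') (mu : probability S R).
Variables (W : S * S -> R) (X : nat -> Omega -> S).
Hypotheses (kW : is_kernel W) (rW : represents mu W Gamma) (iidX : iid P mu X).

Lemma kernel_prod01 (I : Type) (r : seq I) (Q : pred I) (z : I -> S * S) :
  0 <= \prod_(i <- r | Q i) W (z i) <= 1.
Proof.
have [_ _ W01] := kW; elim/big_ind: _ => [|x y /andP[x0 x1] /andP[y0 y1]|i _].
- by rewrite ler01 lexx.
- by rewrite mulr_ge0// mulr_ile1.
- exact: W01.
Qed.

Lemma measurable_kernel_prod n (F : {set 'I_n * 'I_n}) d1 (T : measurableType d1)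
    (Z : T -> 'I_n -> S) : (forall i, measurable_fun [set: T] (Z ^~ i)) ->
  measurable_fun [set: T] (fun t => (\prod_(p in F) W (Z t p.1, Z t p.2))%:E).
Proof.
move=> mZ; apply/measurable_EFinP.
rewrite (_ : (fun _ => _) = fun t => \prod_(p <- enum F) W (Z t p.1, Z t p.2)).
  apply: measurable_prod => p _; have [mW _ _] := kW.
  by apply: (measurableT_comp mW); apply: measurable_fun_pair.
by apply/funext => t; rewrite big_enum.
Qed.

(** The probability that a fixed graph is contained in the random graph. *)
Lemma kernel_prod_integral n (F : {set 'I_n.+1 * 'I_n.+1}) : F \subset upper_pairs n.+1 ->
  (\int[P]_w (\prod_(p in F) W (X p.1 w, X p.2 w))%:E)%E = (Gamma (graph_of F))%:E.
Proof.
move=> FU; rewrite (rW (graph_of F)).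
pose f (t : n.+1.-tuple S) := (\prod_(p in F) W (tnth t p.1, tnth t p.2))%:E.
transitivity (\int[P]_w f [tuple X i w | i < n.+1])%E.
  apply: eq_integral => w _; congr (_%:E); apply: eq_bigr => p _.
  by rewrite !tnth_mktuple.
rewrite (iid_integral (f := f) iidX).
- congr power_integral; apply/funext => t; congr (_%:E).
  by apply: eq_bigl => p; rewrite -(edges_graph_of FU).
- by apply: measurable_kernel_prod => i; exact: measurable_tnth.
- by move=> t; rewrite lee_fin; case/andP: (kernel_prod01 (index_enum _) (mem F)
    (fun p : 'I_n.+1 * 'I_n.+1 => (tnth t p.1, tnth t p.2))).
Qed.

Lemma kernel_prod_integrable n (F : {set 'I_n * 'I_n}) : iid P mu X ->
  P.-integrable [set: Omega] (fun w => (\prod_(p in F) W (X p.1 w, X p.2 w))%:E).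
Proof.
move=> [mX _]; apply: (le_integrable measurableT _ _
  (finite_measure_integrable_cst P 1 measurableT)).
  by apply: (@measurable_kernel_prod _ _ _ _ (fun w i => X i w)) => i; exact: mX.
move=> w _ /=; rewrite lee_fin normr1 ger0_norm;
  by case/andP: (kernel_prod01 (index_enum _) (mem F)
    (fun p : 'I_n * 'I_n => (X p.1 w, X p.2 w))).
Qed.

(** Expanding the factors [1 - W] turns presence and absence of edges into containment of
subgraphs, with the same signs as in [graph_prob]. *)
Lemma kernel_integral n (H : {set 'I_n.+1 * 'I_n.+1}) : H \subset upper_pairs n.+1 ->
  (\int[P]_w (\prod_(p in upper_pairs n.+1)
     (if p \in H then W (X p.1 w, X p.2 w) else 1 - W (X p.1 w, X p.2 w)))%:E)%E =
  (graph_prob Gamma H)%:E.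
Proof.
move=> HU.
transitivity (\int[P]_w (\sum_(B : {set 'I_n.+1 * 'I_n.+1} | B \subset upper_pairs n.+1 :\: H)
    ((-1) ^+ #|B|)%:E * (\prod_(p in H :|: B) W (X p.1 w, X p.2 w))%:E))%E.
  apply: eq_integral => w _; rewrite prod_if// -sumEFin.
  by apply: eq_bigr => B _; rewrite EFinM.
rewrite integral_sum//; last first.
  by move=> B; apply: integrableZl => //; exact: kernel_prod_integrable.
rewrite /graph_prob -sumEFin; apply: eq_bigr => B BU.
rewrite integralZl//; last exact: kernel_prod_integrable.
rewrite kernel_prod_integral ?EFinM//.
by rewrite finset.subUset HU (fintype.subset_trans BU)// finset.subsetDl.
Qed.

End Kernel.

Variables (G : Omega -> rel nat) (hR : is_random_graph P Gamma G).

Definition sampled_edges n (w : Omega) : {set 'I_n.+1 * 'I_n.+1} :=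
  edge_set (induced_graph (G w) (n := n.+1)).

Lemma sampled_edgesK n w :
  srel (sampled_edges n w) = induced_graph (G w) (n := n.+1).
Proof.
have [sG iG _ _] := hR; apply: edge_setK; first by move=> i j; exact: sG.
by move=> i; exact: iG.
Qed.

Lemma sampled_edges_eq n (H : {set 'I_n.+1 * 'I_n.+1}) w : H \subset upper_pairs n.+1 ->
  sampled_edges n w = H <->
  forall i j : 'I_n.+1, (i < j)%N -> G w i j = ((i, j) \in H).
Proof.
move=> HU; split=> [<- i j ij|h]; first by rewrite !inE /= ij.
apply/finset.setP => -[i j]; rewrite !inE /=.
case: (boolP (i < j)%N) => [ij|ij] /=; first exact: h.
by apply/esym/negP => /(fintype.subsetP HU); rewrite inE /= (negPf ij).
Qed.

Lemma measurable_sampled_edges n (H : {set 'I_n.+1 * 'I_n.+1}) : H \subset upper_pairs n.+1 ->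
  measurable [set w | sampled_edges n w = H].
Proof.
move=> HU; have [_ _ mG _] := hR.
rewrite (_ : [set w | _] = \bigcap_(p in [set` upper_pairs n.+1])
    [set w | G w p.1 p.2 = (p \in H)]).
  apply: fin_bigcap_measurable => // p _; case: (p \in H); first exact: mG.
  rewrite (_ : [set w | _] = ~` [set w | G w p.1 p.2]).
    by apply: measurableC; exact: mG.
  by apply/seteqP; split=> w /=; [move=> ->|move/negP/negPf].
apply/seteqP; split=> w.
  move=> /(sampled_edges_eq w HU) h [i j] /=; rewrite inE /=; exact: h.
by move=> h; apply/(sampled_edges_eq w HU) => i j ij; apply: (h (i, j)); rewrite /= inE.
Qed.

Lemma random_graph_prob n (H : {set 'I_n.+1 * 'I_n.+1}) : H \subset upper_pairs n.+1 ->
  P [set w | sampled_edges n w = H] = (graph_prob Gamma H)%:E.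
Proof.
move=> HU; have [_ _ _ [d' [S [mu [W [X [kW rW iidX cG]]]]]]] := hR.
rewrite -(kernel_integral kW rW iidX HU).
have := cG n.+1 (fun=> setT) (fun i j => (i, j) \in H) (fun=> measurableT).
rewrite (_ : [set w | forall i : 'I_n.+1, [set: S] (X i w)] = setT); last first.
  by apply/seteqP; split.
rewrite (_ : [set w | _ /\ _] = [set w | sampled_edges n w = H]).
  move=> ->; apply: eq_integral => w _; congr (_%:E).
  by apply: eq_big => [p|[i j] _]; rewrite ?inE.
apply/seteqP; split=> w /=; first by move=> [_ h]; apply/(sampled_edges_eq w HU).
by move/(sampled_edges_eq w HU).
Qed.

Lemma event_bigcup n (B : pred {set 'I_n.+1 * 'I_n.+1}) :
  [set w | B (sampled_edges n w)] =
  \bigcup_(H in [set` [pred H : {set 'I_n.+1 * 'I_n.+1} |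
      (H \subset upper_pairs n.+1) && B H]])
    [set w | sampled_edges n w = H].
Proof.
apply/seteqP; split=> w /=; last by move=> [H /andP[_ BH] ->].
move=> Bw; exists (sampled_edges n w) => //=.
by rewrite inE edge_set_sub.
Qed.

Lemma measurable_event n (B : pred {set 'I_n.+1 * 'I_n.+1}) :
  measurable [set w | B (sampled_edges n w)].
Proof.
rewrite event_bigcup; apply: fin_bigcup_measurable => //.
by move=> H /andP[HU _]; exact: measurable_sampled_edges.
Qed.

(** The law of the first [n.+1] vertices is the one obtained from finite graphs, whatever
kernel and probability space were used. *)
Lemma random_graph_law n (B : pred {set 'I_n.+1 * 'I_n.+1}) :
  P [set w | B (sampled_edges n w)] =
  (limit_mean Gamma (fun H : {set 'I_n.+1 * 'I_n.+1} => (B H)%:R))%:E.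
Proof.
rewrite event_bigcup measure_fin_bigcup//; last 2 first.
- by move=> H H' _ _ [w [/= <- <-]].
- by move=> H /andP[HU _]; exact: measurable_sampled_edges.
rewrite -(bigfs _ (r := index_enum _)) ?index_enum_uniq//; last first.
  by move=> H _; rewrite mem_index_enum.
rewrite /limit_mean -sumEFin big_mkcondr/=; apply: eq_bigr => H HU.
by case: (B H); rewrite ?mul1r ?mul0r// random_graph_prob.
Qed.

Hypothesis hG : graph_limit Gamma.

Lemma trivial_no_edges : Gamma = trivial_limit -> forall n,
  \forall w \ae P, forall i j : 'I_n, ~~ induced_graph (G w) i j.
Proof.
move=> G0 [|n]; first by apply: aeW => w [].
have [sG iG _ _] := hR.
have P0 : P [set w | sampled_edges n w != finset.set0] = 0%E.
  by rewrite (random_graph_law (fun H => H != finset.set0)) limit_mean_trivial// eqxx.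
exists [set w | sampled_edges n w != finset.set0]; split => //.
  exact: (@measurable_event n (fun H => H != finset.set0)).
move=> w /= nh; apply/negP => /eqP E0; apply: nh => i j.
by rewrite -sampled_edgesK E0 /srel !inE andbF.
Qed.

Lemma C1_fractionE n w :
  C1_fraction G n.+1 w = comp_frac R (srel (sampled_edges n w)).
Proof. by rewrite sampled_edgesK /C1_fraction /comp_frac card_ord. Qed.

Lemma limit_mean_mono n (f g : {set 'I_n.+1 * 'I_n.+1} -> R) :
  (forall H, f H <= g H) -> limit_mean Gamma f <= limit_mean Gamma g.
Proof.
by move=> fg; apply: ler_sum => H HU; apply: ler_wpM2r => //; exact: graph_prob_ge0.
Qed.

Variables (rho : R) (hrho : component_density Gamma rho).

(** If [Z >= rho + eps], then [Y k >= (rho + eps) ^ (k + 1)], which exceeds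
[rho ^ k >= s k] by a fixed amount for suitable [k]; if [Z <= rho - eps], then
[Y k <= (rho - eps) ^ k], which is below [rho ^ (k + 1) <= s k]. Either deviation forces
a deviation of an average of [conn_stat]. *)
Lemma deviation_bound (eps : R) : 0 < eps -> exists k1 k2 (delta : R), 0 < delta /\
  forall (T : finType) (e : rel T), (0 < #|T|)%N -> symmetric e ->
    eps <= `|comp_frac R e - rho| ->
    delta <= (stat_avg R (@conn_stat k1) e - conn_limit Gamma k1) ^+ 2 +
             (stat_avg R (@conn_stat k2) e - conn_limit Gamma k2) ^+ 2.
Proof.
move=> e0; have r0 := density_ge0 hrho.
have [k1 hk1] : exists k, rho ^+ k < (rho + eps) ^+ k.+1.
  by apply: expr_lt_exprS => //; lra.
have [k2 [d2 [d20 hd2]]] : exists k2 (d2 : R), 0 < d2 /\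
    (0 <= rho - eps -> d2 <= rho ^+ k2.+1 - (rho - eps) ^+ k2).
  (* Deviations below a negative bound do not occur. *)
  have [re|re] := lerP 0 (rho - eps); last by exists 0%N, 1.
  have [k2 hk2] := @expr_lt_exprS _ (rho - eps) rho re ltac:(lra).
  by exists k2, (rho ^+ k2.+1 - (rho - eps) ^+ k2); rewrite subr_gt0.
pose d1 := (rho + eps) ^+ k1.+1 - rho ^+ k1.
have d10 : 0 < d1 by rewrite subr_gt0.
exists k1, k2, (Num.min (d1 ^+ 2) (d2 ^+ 2)); split.
  by rewrite lt_min !exprn_gt0.
move=> T e T0 es dev; have Z0 := comp_frac_ge0 R e.
have /andP[l1 _] := comp_frac_conn R k1 T0 es.
have /andP[_ u2] := comp_frac_conn R k2 T0 es.
have /andP[_ s1] := hrho.2 k1.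
have /andP[s2 _] := hrho.2 k2.
have sq (x y : R) : 0 < x -> x <= y -> x ^+ 2 <= y ^+ 2.
  by move=> x0 xy; rewrite lerXn2r ?nnegrE//; lra.
case: (lerP rho (comp_frac R e)) => [rZ|Zr].
  have Ze : rho + eps <= comp_frac R e by move: dev; rewrite ger0_norm; lra.
  rewrite ge_min; apply/orP; left.
  apply: (@le_trans _ _ ((stat_avg R (@conn_stat k1) e - conn_limit Gamma k1) ^+ 2)).
    apply: sq => //; rewrite /d1.
    have : (rho + eps) ^+ k1.+1 <= comp_frac R e ^+ k1.+1.
      by rewrite lerXn2r ?nnegrE//; lra.
    by lra.
  by rewrite lerDl sqr_ge0.
have Ze : comp_frac R e <= rho - eps by move: dev; rewrite ltr0_norm; lra.
have re : 0 <= rho - eps by lra.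
rewrite ge_min; apply/orP; right.
apply: (@le_trans _ _ ((stat_avg R (@conn_stat k2) e - conn_limit Gamma k2) ^+ 2)).
  rewrite -[leRHS]sqrrN opprB; apply: sq => //; apply: le_trans (hd2 re) _.
  have : comp_frac R e ^+ k2 <= (rho - eps) ^+ k2 by rewrite lerXn2r ?nnegrE.
  by lra.
by rewrite lerDr sqr_ge0.
Qed.

(** Chebyshev's inequality for the two statistics of [deviation_bound]. *)
Lemma C1_fraction_cvg : cvg_in_probability P (C1_fraction G) rho.
Proof.
move=> eps e0; have [k1 [k2 [delta [d0 dev]]]] := deviation_bound e0.
rewrite -(cvg_shiftS (fun n => P [set w | eps <= `|C1_fraction G n w - rho|])).
pose B n (H : {set 'I_n.+1 * 'I_n.+1}) : bool := eps <= `|comp_frac R (srel H) - rho|.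
rewrite (_ : (fun n => _) = fun n => (limit_mean Gamma (fun H => (@B n H)%:R))%:E); last first.
  apply/funext => n; rewrite -random_graph_law; congr (P _).
  by apply/seteqP; split=> w /=; rewrite C1_fractionE.
apply: cvg_EFin; first by near=> n.
pose V k n := limit_mean Gamma (fun H : {set 'I_n.+1 * 'I_n.+1} =>
    (stat_avg R (@conn_stat k) (srel H) - conn_limit Gamma k) ^+ 2).
have Vc k : V k n @[n --> \oo] --> 0.
  by apply: (stat_avg_variance hG); exact: conn_stat_monotone.
apply: (@squeeze_cvgr _ _ _ _ (fun=> 0) (fun n => delta^-1 * (V k1 n + V k2 n))).
- near=> n => /=; apply/andP; split.
    by apply: sumr_ge0 => H HU; rewrite mulr_ge0 ?graph_prob_ge0.
  apply: (@le_trans _ _ (limit_mean Gamma (fun H : {set 'I_n.+1 * 'I_n.+1} =>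
    delta^-1 * ((stat_avg R (@conn_stat k1) (srel H) - conn_limit Gamma k1) ^+ 2 +
     (stat_avg R (@conn_stat k2) (srel H) - conn_limit Gamma k2) ^+ 2)))).
    apply: limit_mean_mono => H; rewrite /B.
    case: (boolP (eps <= _)) => [bad|_].
      rewrite mulrC ler_pdivlMr// mul1r; apply: dev bad; last exact: srel_sym.
      by rewrite card_ord.
    by rewrite mulr_ge0 ?invr_ge0 ?(ltW d0)// addr_ge0// sqr_ge0.
  rewrite /V /limit_mean -big_split mulr_sumr/=.
  by apply: ler_sum => H _; rewrite -mulrDl mulrA.
- exact: cvg_cst.
- rewrite -[X in _ --> X](mulr0 delta^-1) -[X in _ * X](addr0 0).
  by apply: cvgM; [exact: cvg_cst|exact: cvgD].
Unshelve. all: by end_near. Qed.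

Lemma cvg_in_probability_unique (c : R) :
  cvg_in_probability P (C1_fraction G) c -> c = rho.
Proof.
move=> cc; apply/eqP; rewrite -subr_eq0 -normr_eq0; apply/negPn/negP => n0.
have e0 : 0 < `|c - rho| / 2 by rewrite divr_gt0// lt_def n0 normr_ge0.
have half : (0 < 2^-1%:E :> \bar R)%E by rewrite lte_fin.
have bad (c' : R) : cvg_in_probability P (C1_fraction G) c' ->
    \forall n \near \oo, (P [set w | (`|c - rho| / 2 <= `|C1_fraction G n.+1 w - c'|)%R]
      < 2^-1%:E)%E.
  move=> /(_ _ e0); rewrite -(cvg_shiftS (fun n => P [set w | _])).
  move=> /fine_cvgP[fin lim0].
  have lt2 := cvgr_lt _ lim0 2^-1 ltac:(by rewrite invr_gt0).
  near=> n; rewrite -[X in (X < _)%E]fineK ?lte_fin; near: n; first exact: lt2.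
  exact: fin.
near \oo => n.
(* If [c] and [rho] differed, the fraction could not be close to both, so that the two
   small events would cover the whole space. *)
have b1 : (P [set w | (`|c - rho| / 2 <= `|C1_fraction G n.+1 w - c|)%R] < 2^-1%:E)%E.
  by near: n; exact: bad.
have b2 : (P [set w | (`|c - rho| / 2 <= `|C1_fraction G n.+1 w - rho|)%R] < 2^-1%:E)%E.
  by near: n; apply: bad; exact: C1_fraction_cvg.
have mE c' : measurable [set w | (`|c - rho| / 2 <= `|C1_fraction G n.+1 w - c'|)%R].
  have := @measurable_event n (fun H => `|c - rho| / 2 <= `|comp_frac R (srel H) - c'|).
  congr (measurable _).
  by apply/seteqP; split=> w /=; rewrite C1_fractionE.
have := measureU2 P (mE c) (mE rho).
rewrite (_ : _ `|` _ = setT).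
  apply/negP; rewrite -ltNge; apply: lt_le_trans (lteD b1 b2) _.
  apply: (@le_trans _ _ 1%E); first by rewrite -EFinD lee_fin; lra.
  by have := lexx (1%E : \bar R); rewrite -{2}(probability_setT P).
apply/seteqP; split=> // w _ /=.
set Z := C1_fraction G n.+1 w.
have ineq : `|c - rho| <= `|Z - c| + `|Z - rho|.
  by rewrite -(distrC c Z); apply: le_trans (ler_normD _ _); rewrite addrA subrK.
by case: (lerP (`|c - rho| / 2) `|Z - c|) => h; [left|right; lra].
Unshelve. all: by end_near. Qed.

End RandomGraphLaw.

Theorem theorem1p20 (R : realType) (Gamma : graph -> R)
    (hGamma : graph_limit Gamma) :
  (forall (d : measure_display) (Omega : measurableType d)
          (P : probability Omega R) (G : Omega -> rel nat),
     is_random_graph P Gamma G ->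
     (limit_connected Gamma <-> cvg_in_probability P (C1_fraction G) 1)) /\
  (exists rho : R,
     [/\ 0 <= rho <= 1 /\
         (forall (d : measure_display) (Omega : measurableType d)
                 (P : probability Omega R) (G : Omega -> rel nat),
            is_random_graph P Gamma G ->
            cvg_in_probability P (C1_fraction G) rho),
         limit_connected Gamma -> rho = 1,
         limit_disconnected Gamma -> 0 <= rho < 1,
         (rho = 0 <-> Gamma = trivial_limit) /\
         (Gamma = trivial_limit ->
          forall (d : measure_display) (Omega : measurableType d)
                 (P : probability Omega R) (G : Omega -> rel nat),
            is_random_graph P Gamma G ->
            forall n : nat,
              \forall w \ae P, forall i j : 'I_n, ~~ induced_graph (G w) i j) &
         forall (M : option nat) (alpha : nat -> R)
                (Gammas : nat -> graph -> R),
           component_decomposition M alpha Gammas Gamma ->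
           is_max_weight M alpha rho]).
Proof.
have [rho [hrho conn1]] := connected_density1 hGamma.
have lt1 := density_lt1_of_disconnected hGamma hrho.
split.
  move=> d Omega P G hR; split=> [/conn1 <-|c1 disc].
    exact: (C1_fraction_cvg hR hGamma hrho).
  have := lt1 disc.
  by rewrite -(cvg_in_probability_unique hR hGamma hrho c1) ltxx.
exists rho; split=> //.
- split; first exact: hrho.1.
  by move=> d Omega P G hR; exact: (C1_fraction_cvg hR hGamma hrho).
- by move=> disc; rewrite lt1// andbT; exact: density_ge0 hrho.
- split.
    split=> [r0|G0]; first by move: hrho; rewrite r0; exact: trivial_of_density0.
    exact: density_of_trivial G0 hrho.
  by move=> G0 d Omega P G hR; exact: (trivial_no_edges hR G0).
- by move=> M alpha Gammas; exact: (density_is_max_weight hGamma hrho).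
Qed.
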